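(* Let $G$ be a Lie group and let $M$ be a $G$-manifold with proper $G$-action admitting a linear slice $S$ at every point $m \in M$. Assume that the $G_m$-action on $S$ has a linear slice (at every point of $S$). Moreover, assume that the approximation property $M_{\geq(H)}\subseteq\overline{M_{(H)}}$ holds for every orbit type $(H)$. Let $(K)\le(H)$ be two orbit types and let $m\in M_{(H)}$. Then there exists an open neighborhood $V$ of $m$ in $M$ such that for all $v\in V\cap M_{(K)}$ there is an injective continuous linear map $T_mM_{(H)}\to T_vM_{(K)}$. In particular, the orbit type stratification of $M$ (the partition into the subsets $M_{(H)}$) is smoothly regular.
   Context: Manifolds are smooth Hausdorff manifolds modelled on locally convex spaces (smoothness in the Michal--Bastiani sense; the model space may vary from chart to chart, and different connected components may have non-isomorphic model spaces), and Lie groups are groups in this category. A submanifold is a subset that in suitable charts of the ambient manifold corresponds to a closed linear subspace of the model space (not necessarily complemented). A $G$-manifold is a manifold $M$ with a smooth left action $(g,m)\mapsto g\cdot m$; $G_m$ is the stabilizer of $m$. The action is proper if $G\times M\to M\times M$, $(g,m)\mapsto(g\cdot m,m)$ is proper (preimages of compact sets are compact). A Lie subgroup $H\subseteq G$ is principal if $G\to G/H$ is a (smooth, locally trivial) principal $H$-bundle. $(H)$ denotes the conjugacy class of $H$ in $G$; orbit types are the classes $(G_m)$, $m\in M$. One writes $(H)\le(K)$ if $aHa^{-1}\subseteq K$ for some $a\in G$. Put $M_{(H)}=\{m\in M:(G_m)=(H)\}$ and $M_{\ge(H)}=\{m\in M:(H)\le(G_m)\}$. If slices exist at every point, each $M_{(H)}$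 is a locally closed submanifold of $M$. A slice at $m\in M$ is a submanifold $S\subseteq M$ containing $m$ such that: (SL1) $G_m\cdot S\subseteq S$. (SL2) Any $g\in G$ with $(g\cdot S)\cap S\neq\emptyset$ lies in $G_m$. (SL3) $G_m$ is a principal Lie subgroup of $G$ and $G\to G/G_m$ admits a smooth local section $\chi: G/G_m\supseteq U\to G$ on an open neighborhood $U$ of the identity coset $[e]$ such that $U\times S\to M$, $([g],s)\mapsto\chi([g])\cdot s$ is a diffeomorphism onto an open neighborhood of $m$ in $M$. (SL4) $S_{(G_m)}=\{s\in S: G_s\text{ is conjugate to }G_m\}$ is a closed submanifold of $S$. A slice $S$ at $m$ is a linear slice if moreover: (SL5) There exist a continuous representation of $G_m$ on a locally convex vector space $X$ and a $G_m$-equivariant diffeomorphism from a $G_m$-invariant open neighborhood of $0$ in $X$ onto $S$ sending $0$ to $m$. A partition of a Hausdorff space $X$ into subsets $X_\sigma$ is a stratification if (DS1) every $X_\sigma$ is a locally closed manifold (with manifold topology equal to the relative topology), and (DS2) every pair of disjoint pieces $X_\varsigma,X_\sigma$ with $X_\varsigma\cap\overline{X_\sigma}\neq\emptyset$ satisfies $X_\varsigma\subseteq\overline{X_\sigma}\setminus X_\sigma$ and $X_\sigma\cap\overline{X_\varsigma}=\emptyset$; in this case one writes $X_\varsigma<X_\sigma$. A pair of strata with $X_\varsigma<X_\sigma$ is smoothly regular if for all $x\in X_\varsigma$ there is an open neighborhood $U$ of $x$ in $X$ such that for all $y\in U\cap X_\sigma$ there exists an injective continuous linear map $T_xX_\varsigma\to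 T_yX_\sigma$. A stratified space is smoothly regular if all its strata are pairwise smoothly regular. *)

(* Defs.v *)
From HB Require Import structures.
From mathcomp Require Import all_boot all_order all_algebra generic_quotient.
From mathcomp Require Import all_classical all_reals all_analysis.

Set Implicit Arguments.
Unset Strict Implicit.
Unset Printing Implicit Defensive.

Import Order.TTheory GRing.Theory Num.Theory numFieldNormedType.Exports.
Local Open Scope classical_set_scope.
Local Open Scope ring_scope.

Section Calculus.
Context {R : realType}.

Definition dirderiv (E F : tvsType R) (f : E -> F) (x h : E) (l : F) : Prop :=
  (fun t : R => t^-1 *: (f (x + t *: h) - f x)) @ 0^' --> l.

(* Meant for open [U]; the values of [f] outside of [U] are irrelevant.       *)
Fixpoint Ck (k : nat) : forall E F : tvsType R, set E -> (E -> F) -> Prop :=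
  match k with
  | 0%N => fun E F U f => {within U, continuous f}
  | k'.+1 => fun E F U f =>
      {within U, continuous f} /\
      exists df : (E * E)%type -> F,
        (forall x h, U x -> dirderiv f x h (df (x, h))) /\
        @Ck k' (E * E)%type F (U `*` setT) df
  end.

Definition smooth (E F : tvsType R) (U : set E) (f : E -> F) : Prop :=
  forall k, Ck k U f.

Definition closed_linear_embedding (E F : tvsType R) (i : E -> F) : Prop :=
  [/\ linear i, injective i, continuous i
    & forall C : set E, closed C -> closed (i @` C)].

End Calculus.

(* All spaces are subsets [carrier] of an ambient topological space, endowed
   with the relative topology and an atlas; so
   submanifolds, submanifolds of those, and subgroups all live on one type.
   Maps are total functions of which only the restriction to the carrier
   matters.  The charts of one atlas may have different model spaces.         *)

Definition rel_open (T : topologicalType) (A U : set T) : Prop :=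
  exists2 O, open O & U = A `&` O.

Definition rel_closed (T : topologicalType) (A B : set T) : Prop :=
  exists2 C, closed C & B = A `&` C.

Definition locally_closed (T : topologicalType) (A : set T) : Prop :=
  exists O C : set T, [/\ open O, closed C & A = O `&` C].

(* [coord] is a bijection from [dom] to [cod], with inverse [param].          *)
Record chart (R : realType) (T : Type) := Chart {
  model : tvsType R;
  dom : set T;
  cod : set model;
  coord : T -> model;
  param : model -> T }.
Arguments Chart {R T} model dom cod coord param.
Arguments model {R T} c.
Arguments dom {R T} c.
Arguments cod {R T} c.
Arguments coord {R T} c.
Arguments param {R T} c.

Record smooth_space (R : realType) (T : Type) := SmoothSpace {
  carrier : set T;
  atlas : chart R T -> Prop }.

Section Manifolds.
Context {R : realType}.

Definition is_chart (T : topologicalType) (A : set T) (c : chart R T) : Prop :=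
  [/\ hausdorff_space (model c), rel_open A (dom c) & open (cod c)] /\
  [/\ set_fun (dom c) (cod c) (coord c), set_fun (cod c) (dom c) (param c),
      {in dom c, cancel (coord c) (param c)}
    & {in cod c, cancel (param c) (coord c)}] /\
  {within dom c, continuous coord c} /\ {within cod c, continuous param c}.

Definition smooth_transition (T : Type) (c d : chart R T) : Prop :=
  smooth (cod c `&` param c @^-1` dom d) (coord d \o param c).

(* membership in the maximal atlas *)
Definition compatible_chart (T : topologicalType) (X : smooth_space R T)
    (c : chart R T) : Prop :=
  is_chart (carrier X) c /\
  forall d, atlas X d -> smooth_transition c d /\ smooth_transition d c.

Definition manifold (T : topologicalType) (X : smooth_space R T) : Prop :=
  [/\ hausdorff_space (subspace (carrier X)),
      forall x, carrier X x -> exists2 c, atlas X c & dom c x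
    & forall c, atlas X c -> compatible_chart X c].

Definition smooth_map (T T' : topologicalType) (X : smooth_space R T)
    (Y : smooth_space R T') (f : T -> T') : Prop :=
  [/\ set_fun (carrier X) (carrier Y) f, {within carrier X, continuous f}
    & forall c d, atlas X c -> atlas Y d ->
        smooth (cod c `&` (f \o param c) @^-1` dom d)
               (coord d \o f \o param c)].

Definition diffeo (T T' : topologicalType) (X : smooth_space R T)
    (Y : smooth_space R T') (f : T -> T') : Prop :=
  smooth_map X Y f /\
  exists g, [/\ smooth_map Y X g, {in carrier X, cancel f g}
              & {in carrier Y, cancel g f}].

Definition lcs_space (E : tvsType R) : smooth_space R E :=
  SmoothSpace setT (fun c => c = Chart E setT setT id id).

Definition prod_chart (T T' : Type) (c : chart R T) (d : chart R T') :
    chart R (T * T') :=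
  Chart (model c * model d)%type (dom c `*` dom d) (cod c `*` cod d)
    (fun p => (coord c p.1, coord d p.2))
    (fun p => (param c p.1, param d p.2)).

Definition prod_space (T T' : Type) (X : smooth_space R T)
    (Y : smooth_space R T') : smooth_space R (T * T') :=
  SmoothSpace (carrier X `*` carrier Y)
    (fun e => exists c d, [/\ atlas X c, atlas Y d & e = prod_chart c d]).

(* [c'] is the restriction to [A] of a chart [c] of the ambient manifold which
   maps [A] to a closed linear subspace, the latter being presented as the
   image of a closed linear embedding [i] of the model space of [c'].         *)
Definition sub_chart (T : topologicalType) (X : smooth_space R T) (A : set T)
    (c' : chart R T) : Prop :=
  exists (c : chart R T) (i : model c' -> model c),
    [/\ compatible_chart X c, closed_linear_embedding i
      & coord c @` (dom c `&` A) = cod c `&` range i] /\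
    [/\ dom c' = dom c `&` A, cod c' = i @^-1` cod c,
        {in dom c', i \o coord c' =1 coord c}
      & {in cod c', param c' =1 param c \o i}].

(* For an open [A] these are the charts of the open submanifold [A].          *)
Definition sub_space (T : topologicalType) (X : smooth_space R T) (A : set T) :
    smooth_space R T :=
  SmoothSpace A (sub_chart X A).

Definition submanifold (T : topologicalType) (X : smooth_space R T)
    (A : set T) : Prop :=
  A `<=` carrier X /\ forall x, A x -> exists2 c, sub_chart X A c & dom c x.

(* The tangent vector at [x] which is represented by [v] in the chart [c]: the
   class of all pairs (chart around [x], vector) that correspond to [(c, v)]
   under the derivatives of the transition maps.                              *)
Definition tangent_vector (T : topologicalType) (X : smooth_space R T) (x : T)
    (c : chart R T) (v : model c) (p : {d : chart R T & model d}) : Prop :=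
  [/\ atlas X (tag p), dom (tag p) x
    & dirderiv (coord (tag p) \o param c) (coord c x) v (tagged p)].

Definition tangent_space (T : topologicalType) (X : smooth_space R T) (x : T)
    (xi : {d : chart R T & model d} -> Prop) : Prop :=
  exists (c : chart R T) (v : model c),
    [/\ atlas X c, dom c x & xi = tangent_vector X x v].

(* The topological vector space structure of the tangent space at [x] is the
   one for which [tangent_vector X x] is an isomorphism for any chart.        *)
Definition injective_continuous_linear (T T' : topologicalType)
    (X : smooth_space R T) (x : T) (Y : smooth_space R T') (y : T')
    (A : ({d : chart R T & model d} -> Prop) ->
         ({d : chart R T' & model d} -> Prop)) : Prop :=
  [/\ forall xi, tangent_space X x xi -> tangent_space Y y (A xi),
      forall xi eta, tangent_space X x xi -> tangent_space X x eta ->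
        A xi = A eta -> xi = eta
    & forall c d, atlas X c -> dom c x -> atlas Y d -> dom d y ->
      exists L : model c -> model d, [/\ linear L, continuous L
        & forall v, A (tangent_vector X x v) = tangent_vector Y y (L v)]].

Definition frontier_rel (T : topologicalType) (X Y : smooth_space R T) : Prop :=
  carrier X `&` carrier Y = set0 /\ carrier X `&` closure (carrier Y) !=set0.

Definition stratification (T : topologicalType) (P : smooth_space R T -> Prop) :=
  [/\ hausdorff_space T,
      [/\ forall x, exists2 X, P X & carrier X x,
          forall X, P X -> carrier X !=set0
        & forall X Y, P X -> P Y ->
            carrier X `&` carrier Y !=set0 -> X = Y],
      forall X, P X -> manifold X /\ locally_closed (carrier X)
    & forall X Y, P X -> P Y -> frontier_rel X Y ->
        carrier X `<=` closure (carrier Y) `\` carrier Y /\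
        carrier Y `&` closure (carrier X) = set0].

Definition smoothly_regular_pair (T : topologicalType)
    (X Y : smooth_space R T) : Prop :=
  forall x, carrier X x -> exists U : set T, [/\ open U, U x
    & forall y, U y -> carrier Y y ->
        exists A, injective_continuous_linear X x Y y A].

Definition smoothly_regular (T : topologicalType)
    (P : smooth_space R T -> Prop) : Prop :=
  stratification P /\
  forall X Y, P X -> P Y -> frontier_rel X Y -> smoothly_regular_pair X Y.

End Manifolds.

(* Only the join of the two structures: the compatibility is part of
   [lie_group].                                                               *)
#[short(type="preTopologicalGroupType")]
HB.structure Definition PreTopologicalGroup :=
  {G of Topological G & Group G}.

Section Cosets.
Local Open Scope quotient_scope.
Context {Gt : preTopologicalGroupType} (H : set Gt).

Definition left_coset (g : Gt) : set Gt := [set (g * h)%g | h in H].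

Definition coset_rel (x y : Gt) : bool := `[< left_coset x = left_coset y >].

Lemma coset_rel_refl : reflexive coset_rel.
Proof. by move=> x; apply/asboolP. Qed.

Lemma coset_rel_sym : symmetric coset_rel.
Proof. by move=> x y; apply/asboolP/asboolP. Qed.

Lemma coset_rel_trans : transitive coset_rel.
Proof. by move=> y x z /asboolP xy /asboolP yz; apply/asboolP; rewrite xy. Qed.

Definition coset_equiv :=
  EquivRel coset_rel coset_rel_refl coset_rel_sym coset_rel_trans.

Definition coset_space : topologicalType :=
  quotient_topology {eq_quot coset_equiv}.

Definition coset_proj (g : Gt) : coset_space :=
  \pi_(quotient_topology {eq_quot coset_equiv}) g.

End Cosets.

Section Groups.
Context {R : realType} {Gt : preTopologicalGroupType}.
Implicit Types (G : smooth_space R Gt) (H K : set Gt).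

Definition is_subgroup H : Prop :=
  [/\ H 1%g, forall g h, H g -> H h -> H (g * h)%g
    & forall g, H g -> H (g^-1)%g].

Definition lie_group G : Prop :=
  [/\ manifold G, is_subgroup (carrier G),
      smooth_map (prod_space G G) G (fun p => (p.1 * p.2)%g)
    & smooth_map G G (fun g => (g^-1)%g)].

Definition lie_subgroup G H : Prop := is_subgroup H /\ submanifold G H.

(* With the structure [Q] on the coset space G/H, the projection G -> G/H is a
   principal H-bundle.  (If G is itself a proper subgroup of the ambient group,
   then the quotient topology of G/H is the relative topology of the image of G
   in the space of all left cosets of H.)                                     *)
Definition principal_bundle G H (Q : smooth_space R (coset_space H)) : Prop :=
  [/\ manifold Q, carrier Q = coset_proj H @` carrier G,
      smooth_map G Q (coset_proj H)
    & forall q, carrier Q q ->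
      exists (U : set (coset_space H)) (Phi : coset_space H * Gt -> Gt),
        [/\ rel_open (carrier Q) U, U q,
            diffeo (prod_space (sub_space Q U) (sub_space G H))
              (sub_space G (carrier G `&` coset_proj H @^-1` U)) Phi,
            forall u h, U u -> H h -> coset_proj H (Phi (u, h)) = u
          & forall u h k, U u -> H h -> H k ->
              Phi (u, (h * k)%g) = (Phi (u, h) * k)%g]].

Definition conj_set (a : Gt) H : set Gt := [set (a * h * a^-1)%g | h in H].

(* (H) = (K) and (H) <= (K) in G *)
Definition conj_eq G H K : Prop :=
  exists2 a, carrier G a & conj_set a H = K.

Definition conj_le G H K : Prop :=
  exists2 a, carrier G a & conj_set a H `<=` K.

End Groups.

Section Actions.
Context {R : realType} {Gt : preTopologicalGroupType} {T : topologicalType}.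
Variables (G : smooth_space R Gt) (M : smooth_space R T) (act : Gt -> T -> T).

Definition G_manifold : Prop :=
  [/\ manifold M, forall x, carrier M x -> act 1%g x = x,
      forall g h x, carrier G g -> carrier G h -> carrier M x ->
        act (g * h)%g x = act g (act h x)
    & smooth_map (prod_space G M) M (fun p => act p.1 p.2)].

Definition proper_action : Prop :=
  forall C : set (T * T), C `<=` carrier M `*` carrier M -> compact C ->
    compact ((carrier G `*` carrier M) `&`
             (fun p : Gt * T => (act p.1 p.2, p.2)) @^-1` C).

Definition stab (x : T) : set Gt := [set g | carrier G g /\ act g x = x].

Definition orbit_type (H : set Gt) : Prop :=
  exists2 x, carrier M x & conj_eq G (stab x) H.

Definition type_eq (H : set Gt) : set T :=
  [set x | carrier M x /\ conj_eq G (stab x) H].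

Definition type_ge (H : set Gt) : set T :=
  [set x | carrier M x /\ conj_le G H (stab x)].

Definition orbit_type_strata (X : smooth_space R T) : Prop :=
  exists2 H, orbit_type H & X = sub_space M (type_eq H).

Definition SL1 (m : T) (S : set T) : Prop :=
  forall g s, stab m g -> S s -> S (act g s).

Definition SL2 (m : T) (S : set T) : Prop :=
  forall g, carrier G g -> act g @` S `&` S !=set0 -> stab m g.

Definition SL3 (m : T) (S : set T) : Prop :=
  lie_subgroup G (stab m) /\
  exists2 Q : smooth_space R (coset_space (stab m)), principal_bundle G Q &
  exists (U : set (coset_space (stab m))) (chi : coset_space (stab m) -> Gt)
         (O : set T),
    [/\ rel_open (carrier Q) U, U (coset_proj (stab m) 1%g),
        smooth_map (sub_space Q U) G chi
      & forall u, U u -> coset_proj (stab m) (chi u) = u] /\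
    [/\ rel_open (carrier M) O, O m
      & diffeo (prod_space (sub_space Q U) (sub_space M S)) (sub_space M O)
          (fun p => act (chi p.1) p.2)].

Definition SL4 (m : T) (S : set T) : Prop :=
  submanifold (sub_space M S) (S `&` type_eq (stab m)) /\
  rel_closed S (S `&` type_eq (stab m)).

Definition slice (m : T) (S : set T) : Prop :=
  [/\ submanifold M S, S m & [/\ SL1 m S, SL2 m S, SL3 m S & SL4 m S]].

Definition continuous_representation (H : set Gt) (X : tvsType R)
    (rho : Gt -> X -> X) : Prop :=
  [/\ forall g, H g -> linear (rho g), forall x, rho 1%g x = x,
      forall g h x, H g -> H h -> rho (g * h)%g x = rho g (rho h x)
    & {within H `*` setT, continuous (fun p : Gt * X => rho p.1 p.2)}].

Definition SL5 (m : T) (S : set T) : Prop :=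
  exists (X : tvsType R) (rho : Gt -> X -> X) (W : set X) (f : X -> T),
    [/\ hausdorff_space X, continuous_representation (stab m) rho,
        open W, W 0 & forall g x, stab m g -> W x -> W (rho g x)] /\
    [/\ diffeo (sub_space (lcs_space X) W) (sub_space M S) f, f 0 = m
      & forall g x, stab m g -> W x -> f (rho g x) = act g (f x)].

Definition linear_slice (m : T) (S : set T) : Prop := slice m S /\ SL5 m S.

End Actions.

(* Main.v *)
Require Import Defs.
From mathcomp Require Import all_boot all_order all_algebra.
From mathcomp Require Import ring lra.
From mathcomp Require Import all_classical all_reals all_analysis.
Set Implicit Arguments.
Unset Strict Implicit.
Unset Printing Implicit Defensive.
Import Order.TTheory GRing.Theory Num.Theory numFieldNormedType.Exports.
Local Open Scope classical_set_scope.
Local Open Scope ring_scope.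
Local Notation coord := Defs.coord.

(** Let [H] be the stabilizer of [m], and let the slice at [m] be the image under
    [f] of an open set [W] in a representation [E] of [H]. A neighbourhood of [m]
    is then a product of an open set of [G / H] and [W]: its points are
    [act (sigma y) (f x)], with a local section [sigma] of [G -> G / H]
    ([slice_chart]). The sets [M_(K)] are [G]-invariant, so in this chart [M_(K)] is
    described by a condition on [x] alone, namely that [f x] has orbit type [(K)].
    The stabilizer of [f x] consists of the [h] in [H] which fix the vector [x].
    Hence, if [E^H] is the space of vectors fixed by [H] and [Q] the model space of
    [G / H]:
    - each [M_(K)] near [m] is invariant under small translations by [E^H], which do
      not change stabilizers, so its tangent spaces contain [Q * E^H];
    - a point [x] with [f x] in [M_(H)] lies in [E^H], since the stabilizer of [f x]
      is contained in [H] and conjugate to [H], hence equal to [H]; so the tangent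
      space of [M_(H)] at [m] is contained in [Q * E^H].
    The injection of tangent spaces is the resulting inclusion
    ([orbit_type_tangent_maps]).

    The delicate point is that a conjugate [L = a H a^-1] contained in [H] equals
    [H] ([slice_stab_eq]). The group [H] is compact because the action is proper, so
    its model space is locally compact, and by Riesz's argument a closed linear
    embedding of this space into itself is onto
    ([locally_compact_embedding_onto]). This applies to the differential of the
    conjugation by [a]. The projection from [H] to [H / L] is constant on [L], so
    its differential is zero. But the projection has a smooth section, by the slice
    for the action of [H] on the slice at [m]; so [H / L] is discrete, and [L] is
    open in [H] ([conjugate_subgroup_open]). Iterating the conjugation, one gets a
    decreasing sequence of clopen subgroups of [H], which becomes stationary since
    [H] is compact and locally connected ([conjugate_subgroup_eq]).

    That the sets [M_(H)] are submanifolds follows from (SL4) and the product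
    structure ([type_eq_sub_chart]). As stabilizers near a point [x] are conjugate to
    subgroups of the stabilizer of [x], a set [M_(K)] which meets the closure of
    [M_(H)] satisfies [(H) <= (K)], and the approximation property puts all of
    [M_(K)] into this closure. The converse accumulation is excluded because, by
    (SL4), each [M_(H)] is closed near its points
    ([orbit_type_stratification]).

    The calculus rests on a mean value theorem for convex open sets ([mean_value]),
    from which a continuous directional derivative is seen to be strict
    ([strict_derivative]); the chain rule and the linearity of the derivative
    follow. *)

(** * Topological vector spaces *)

Lemma open_setX (T U : topologicalType) (A : set T) (B : set U) :
  open A -> open B -> open (A `*` B).
Proof.
rewrite !openE => oA oB [a b] [/= Aa Bb]; exists (A, B) => //=.
by split; [exact: oA|exact: oB].
Qed.

Section TvsTopology.
Context {R : realType}.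

Lemma tvs_cvgD (E : tvsType R) (I : Type) (F : set_system I) {FF : Filter F}
    (f g : I -> E) (a b : E) :
  f @ F --> a -> g @ F --> b -> (fun x => f x + g x) @ F --> a + b.
Proof.
move=> fa gb.
apply: (@cvg_comp _ _ _ (fun x => (f x, g x)) (fun p : E * E => p.1 + p.2)
          _ (nbhs (a, b))); first exact: cvg_pair.
exact: (@add_continuous E (a, b)).
Qed.

Lemma tvs_cvgZ (E : tvsType R) (I : Type) (F : set_system I) {FF : Filter F}
    (k : I -> R) (f : I -> E) (r : R) (a : E) :
  k @ F --> r -> f @ F --> a -> (fun x => k x *: f x) @ F --> r *: a.
Proof.
move=> kr fa.
apply: (@cvg_comp _ _ _ (fun x => (k x, f x)) (fun p : R^o * E => p.1 *: p.2)
          _ (nbhs ((r : R^o), a))).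
  by apply: (@cvg_pair _ _ _ _ (nbhs (r : R^o)) (nbhs a)).
exact: (@scale_continuous R E (r, a)).
Qed.

Lemma tvs_cvgN (E : tvsType R) (I : Type) (F : set_system I) {FF : Filter F}
    (f : I -> E) (a : E) :
  f @ F --> a -> (fun x => - f x) @ F --> - a.
Proof.
move=> fa; apply: (@cvg_comp _ _ _ f (fun p : E => - p) _ (nbhs a)) => //.
exact: (@opp_continuous E a).
Qed.

Lemma tvs_cvgB (E : tvsType R) (I : Type) (F : set_system I) {FF : Filter F}
    (f g : I -> E) (a b : E) :
  f @ F --> a -> g @ F --> b -> (fun x => f x - g x) @ F --> a - b.
Proof. by move=> fa gb; apply: tvs_cvgD => //; apply: tvs_cvgN. Qed.

Definition convex (E : lmodType R) (D : set E) :=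
  forall a b s, 0 <= s <= 1 -> D a -> D b -> D (s *: a + (1 - s) *: b).

Lemma nbhs_convex (E : tvsType R) (x : E) (N : set E) : nbhs x N ->
  exists D : set E, [/\ open D, D x, D `<=` N & convex D].
Proof.
move=> xN; have [B Bconv [Bo Bb]] := @locally_convex R E.
have [D [BD Dx] DN] := Bb x N xN.
exists D; split=> //; first exact: Bo.
move=> a b s /andP[s0 s1] Da Db.
have [t ts] : exists t : {i01 R}, t%:num = s.
  by exists (Itv01 s0 s1).
have := Bconv D (mem_set BD) (a : convex_lmodType E) b t (mem_set Da) (mem_set Db).
by rewrite inE /conv /= /convex.conv /= ts.
Qed.

End TvsTopology.

(** * Calculus in locally convex spaces *)

Section MeanValue.
Context {R : realType} {F : tvsType R}.
Implicit Types (g : R -> F) (D : set F).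

(** The slope over a union of two adjacent intervals is a convex combination of
    the two slopes. *)
Lemma slope_join g D (a b c : R) : convex D -> a < b -> b < c ->
  D ((b - a)^-1 *: (g b - g a)) -> D ((c - b)^-1 *: (g c - g b)) ->
  D ((c - a)^-1 *: (g c - g a)).
Proof.
move=> cD ab bc Dab Dbc.
have ac : a < c by exact: lt_trans bc.
have ba0 : b - a != 0 by rewrite subr_eq0 gt_eqF.
have cb0 : c - b != 0 by rewrite subr_eq0 gt_eqF.
have ca0 : c - a != 0 by rewrite subr_eq0 gt_eqF.
pose s := (b - a) / (c - a).
have s01 : 0 <= s <= 1.
  apply/andP; split; first by rewrite divr_ge0 // subr_ge0 ltW.
  by rewrite ler_pdivrMr ?subr_gt0 // mul1r lerD2r ltW.
have := cD _ _ s s01 Dab Dbc; rewrite !scalerA.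
have -> : s / (b - a) = (c - a)^-1.
  by rewrite /s mulrAC divff // mul1r.
have -> : (1 - s) / (c - b) = (c - a)^-1.
  by rewrite /s; field; rewrite ca0 cb0.
by rewrite -scalerDr [X in _ *: X]addrC subrKA.
Qed.

Lemma dnbhs0P (A : set R) :
  (\forall t \near 0^', A t) <-> (exists2 e : R, 0 < e & forall t, t != 0 -> `|t| < e -> A t).
Proof.
split=> [|[e e0 eA]].
  rewrite /dnbhs near_withinE => /nbhs_ballP[e /= e0 eA]; exists e => // t t0 te.
  by apply: eA => //; rewrite /ball /= sub0r normrN.
rewrite /dnbhs near_withinE; apply/nbhs_ballP; exists e => // t.
by rewrite /ball /= sub0r normrN => te t0; apply: eA.
Qed.

(** Mean value theorem without functionals: locally the slopes lie in [D], and
    [slope_join] propagates this from 0 to the supremum of the points reached,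
    hence to 1. *)
Lemma mean_value g D : convex D ->
  (forall s : R, 0 <= s <= 1 -> \forall t \near 0^',
     D (t^-1 *: (g (s + t) - g s))) ->
  D (g 1 - g 0).
Proof.
move=> cD gD.
have loc (s : R) : 0 <= s <= 1 -> exists2 e : R, 0 < e &
    forall a b : R, s - e < a -> a <= s -> s <= b -> b < s + e -> a < b ->
      D ((b - a)^-1 *: (g b - g a)).
  move=> /gD/dnbhs0P[e e0 eD]; exists e => // a b ea as_ sb be ab.
  have sl (c : R) : c != s -> `|c - s| < e -> D ((c - s)^-1 *: (g c - g s)).
    move=> cs ce; have := eD (c - s); rewrite [s + _]addrC subrK.
    by apply=> //; rewrite subr_eq0.
  have slN (c : R) : c != s -> `|c - s| < e -> D ((s - c)^-1 *: (g s - g c)).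
    move=> cs /(sl _ cs); rewrite -[in s - c]opprB invrN scaleNr -scalerN.
    by rewrite opprB.
  have [as'|as'|ase] := ltgtP a s; last 2 first.
  - by move: as_; rewrite leNgt as'.
  - by rewrite ase in ab *; apply: sl; rewrite ?gt_eqF // ltr_norml; lra.
  have [sb'|sb'|sbe] := ltgtP s b; last 2 first.
  - by move: sb; rewrite leNgt sb'.
  - by rewrite -sbe; apply: slN; rewrite ?lt_eqF // ltr_norml; lra.
  apply: (@slope_join g D a s b) => //.
    by apply: slN; rewrite ?lt_eqF // ltr_norml; lra.
  by apply: sl; rewrite ?gt_eqF // ltr_norml; lra.
(* the points reached from 0; their supremum is reached and equals 1 *)
pose P := [set t | 0 < t <= 1 /\ D ((t - 0)^-1 *: (g t - g 0))].
have [e0 e00 De0] : exists2 e : R, 0 < e & forall b : R, 0 < b -> b < e ->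
    D ((b - 0)^-1 *: (g b - g 0)).
  have [|e e0 eD] := loc 0; first by rewrite lexx ler01.
  by exists e => // b b0 be; apply: eD => //; lra.
have Psup : has_sup P.
  split; last by exists 1 => t [/andP[]].
  exists (Num.min (e0 / 2) 1); split.
    rewrite lt_min ge_min lexx ltr01 divr_gt0 //= ?orbT //.
  apply: De0; first by rewrite lt_min ltr01 divr_gt0.
  by rewrite gt_min ltr_pdivrMr // ltr_pMr // ltr1n.
pose s := sup P.
have sP t : P t -> t <= s by exact: sup_upper_bound.
have s0 : 0 < s.
  by have [t Pt] := Psup.1; apply: lt_le_trans (sP _ Pt); case: Pt => /andP[].
have s1 : s <= 1 by apply: ge_sup; [exact: Psup.1|move=> t [/andP[]]].
have [|e e0' eD] := loc s; first by rewrite (ltW s0).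
have [a Pa sa] := sup_adherent e0' Psup.
have Ps : P s.
  split; first by rewrite s0.
  have := sP _ Pa; rewrite le_eqVlt => /predU1P[<-|as_]; first exact: Pa.2.
  apply: (@slope_join g D 0 a s) => //.
  - by case: Pa => /andP[].
  - exact: Pa.2.
  - by apply: eD => //; rewrite ?lexx // ?ltW // ltrDl.
have [s1'|s1'] := ltP s 1; last first.
  have -> : (1 : R) = s by apply/le_anti/andP.
  have := Ps.2.
  have -> : s = 1 by apply/le_anti/andP.
  by rewrite subr0 invr1 scale1r.
pose t := s + Num.min (e / 2) (1 - s).
have m0 : 0 < Num.min (e / 2) (1 - s) by rewrite lt_min divr_gt0 //= subr_gt0.
have Pt : P t.
  split.
    rewrite addr_gt0 //= /t -lerBrDl ge_min lexx orbT //.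
  apply: (@slope_join g D 0 s t) => //; first by rewrite ltrDl.
  - exact: Ps.2.
  - apply: eD; rewrite ?lexx // ?gtrBl ?lerDl ?ltW ?ltrDl //.
    by rewrite ltrD2l gt_min ltr_pdivrMr // ltr_pMr // ltr1n.
by have := sP _ Pt; rewrite leNgt /t ltrDl m0.
Qed.

End MeanValue.

Section Derivative.
Context {R : realType}.
Implicit Types E F G : tvsType R.

Lemma linear_funB E F (i : E -> F) : linear i ->
  forall x y, i (x - y) = i x - i y.
Proof. by move=> li x y; rewrite addrC -scaleN1r li scaleN1r addrC. Qed.

Lemma linear_fun0 E F (i : E -> F) : linear i -> i 0 = 0.
Proof. by move=> li; rewrite -[X in i X](subrr 0) linear_funB // subrr. Qed.

Lemma linear_funZ E F (i : E -> F) : linear i ->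
  forall a x, i (a *: x) = a *: i x.
Proof.
by move=> li a x; rewrite -[a *: x]addr0 li (linear_fun0 li) addr0.
Qed.

Lemma linear_funD E F (i : E -> F) : linear i ->
  forall x y, i (x + y) = i x + i y.
Proof. by move=> li x y; rewrite -[x]scale1r li !scale1r. Qed.

Lemma dirderiv_unique E F (f : E -> F) (x h : E) (l l' : F) :
  hausdorff_space F -> dirderiv f x h l -> dirderiv f x h l' -> l = l'.
Proof. by move=> hF fl fl'; apply: (cvg_unique hF fl fl'). Qed.

Lemma cvg_dnbhs0 : (fun t : R => t) @ 0^' --> (0 : R).
Proof. exact: cvg_within. Qed.

Lemma cvg_ray E (x h : E) : (fun t : R => x + t *: h) @ 0^' --> x.
Proof.
rewrite -[X in _ --> X]addr0 -(scale0r h).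
apply: tvs_cvgD; first exact: cvg_cst.
by apply: tvs_cvgZ; [exact: cvg_dnbhs0|exact: cvg_cst].
Qed.

Lemma near_ray E (x h : E) (U : set E) : open U -> U x ->
  \forall t \near (0 : R)^', U (x + t *: h).
Proof. by move=> oU Ux; apply: (@cvg_ray E x h U); apply: open_nbhs_nbhs. Qed.

Lemma dirderiv_near E F (f g : E -> F) (x h : E) (l : F) :
  f x = g x -> (\forall t \near (0 : R)^', f (x + t *: h) = g (x + t *: h)) ->
  dirderiv f x h l -> dirderiv g x h l.
Proof.
move=> fgx fg; apply: cvg_trans; apply: near_eq_cvg.
by apply: filterS fg => t ->; rewrite fgx.
Qed.

Lemma dirderiv_eqon E F (U : set E) (f g : E -> F) (x h : E) (l : F) :
  open U -> (forall y, U y -> f y = g y) -> U x ->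
  dirderiv f x h l -> dirderiv g x h l.
Proof.
move=> oU fg Ux; apply: dirderiv_near; first exact: fg.
by apply: filterS (near_ray h oU Ux) => t; apply: fg.
Qed.

(** The first step of the recursion in [Ck], with the derivative as a parameter. *)
Definition C1 E F (U : set E) (f : E -> F) (df : E * E -> F) :=
  [/\ open U, forall y k, U y -> dirderiv f y k (df (y, k))
    & {within U `*` setT, continuous df}].

(** A continuous directional derivative is a strict one: the difference quotient
    converges when base point and direction move as well. This is what makes
    the chain rule and the linearity of the derivative work without a norm. *)
Lemma strict_derivative E F (U : set E) (f : E -> F) df (x h : E) :
  C1 U f df -> U x ->
  (fun p : (E * E) * R => p.2^-1 *: (f (p.1.1 + p.2 *: p.1.2) - f p.1.1)) @
    (filter_prod (nbhs (x, h)) (0 : R)^') --> df (x, h).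
Proof.
move=> [oU fdf cdf] Ux N /nbhs_convex[D [oD Dx DN cD]].
have oUT : open (U `*` setT : set (E * E)).
  by apply: open_setX => //; exact: openT.
have UDxh : nbhs (x, h) [set p : E * E | U p.1 /\ D (df p)].
  have UTx : (U `*` setT) (x, h) by split.
  move: cdf; rewrite continuous_open_subspace // => /(_ (x, h) (mem_set UTx)) cx.
  have : nbhs (x, h) ((U `*` setT) `&` df @^-1` D).
    apply: filterI; first exact: open_nbhs_nbhs.
    by apply: cx; apply: open_nbhs_nbhs.
  by apply: filterS => p [[]].
have mcv : (fun q : (E * E) * R => (q.1.1 + q.2 *: q.1.2, q.1.2)) @
   (filter_prod (nbhs (x, h)) (nbhs (0 : R))) --> (x, h).
  apply: (@cvg_pair _ _ _ _ (nbhs x) (nbhs h)).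
    have {2}-> : x = x + 0 *: h by rewrite scale0r addr0.
    apply: tvs_cvgD.
      apply: (@cvg_comp _ _ _ _ _ _ (nbhs (x, h))); [exact: cvg_fst|exact: cvg_fst].
    apply: tvs_cvgZ; first exact: cvg_snd.
    apply: (@cvg_comp _ _ _ _ _ _ (nbhs (x, h))); [exact: cvg_fst|exact: cvg_snd].
  apply: (@cvg_comp _ _ _ _ _ _ (nbhs (x, h))); [exact: cvg_fst|exact: cvg_snd].
have [[A B] /= [nA nB] AB] := mcv _ UDxh.
have [e e0 eB] : exists2 e : R, 0 < e & forall t, `|t| < e -> B t.
  have /nbhs_ballP[e /= e0 eB] := nB; exists e => // t te.
  by apply: eB; rewrite /ball /= sub0r normrN.
exists (A, [set t | t != 0 /\ `|t| < e]) => /=.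
  split=> //; apply/dnbhs0P; exists e => //.
move=> [[y k] t] /= [Ayk [t0 te]]; apply: DN.
(* the slopes of [g] are difference quotients of [f] near [(x, h)], hence in [D] *)
pose g (s : R) := t^-1 *: f (y + (s * t) *: k).
have := @mean_value R F g D cD; rewrite /g mul1r mul0r scale0r addr0 -scalerBr.
apply=> s /andP[s0 s1].
have [/= Us Ds] : U (y + (s * t) *: k) /\ D (df (y + (s * t) *: k, k)).
  apply: (AB ((y, k), s * t)); split => //=; apply: eB.
  rewrite normrM ger0_norm //; apply: le_lt_trans te.
  by rewrite ler_piMl.
have := fdf _ k Us D (open_nbhs_nbhs (conj oD Ds)).
move/dnbhs0P => [d d0 dD]; apply/dnbhs0P; exists (d / `|t|).
  by rewrite divr_gt0 // normr_gt0.
move=> r r0 rd; have := dD (r * t); rewrite mulf_neq0 // normrM -ltr_pdivlMr ?normr_gt0 //.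
move=> /(_ isT rd) /=; rewrite invfM -scalerBr scalerA mulrDl scalerDl addrA.
by [].
Qed.

(** The difference quotient of [f] plays the part of the moving direction in
    [strict_derivative]. *)
Lemma dirderiv_comp E F G (f : E -> F) (g : F -> G) (V : set F) dg
    (x h : E) (l : F) :
  dirderiv f x h l -> C1 V g dg -> V (f x) ->
  dirderiv (g \o f) x h (dg (f x, l)).
Proof.
move=> fl C1g Vfx; have gs := @strict_derivative _ _ _ _ _ _ l C1g Vfx.
have : (fun t : R => ((f x, t^-1 *: (f (x + t *: h) - f x)), t)) @ 0^' -->
    (filter_prod (nbhs (f x, l)) (0 : R)^').
  apply: (@cvg_pair _ _ _ _ (nbhs (f x, l)) (0 : R)^'); last exact: cvg_id.
  by apply: (@cvg_pair _ _ _ _ (nbhs (f x)) (nbhs l)) => //; exact: cvg_cst.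
move=> /cvg_comp/(_ gs); apply: cvg_trans; apply: near_eq_cvg.
near=> t => /=; rewrite scalerA divff ?scale1r; last first.
  by near: t; exact: nbhs_dnbhs_neq.
by rewrite [f x + _]addrC subrK.
Unshelve. all: by end_near. Qed.

Lemma C1_linear E F (U : set E) (f : E -> F) df (x : E) :
  hausdorff_space F -> C1 U f df -> U x -> linear (fun h => df (x, h)).
Proof.
move=> hF C1f Ux; have [oU fdf cdf] := C1f.
(* move by [t h] first: the second increment starts at the moving base point
   [x + t h] *)
have addf h k : df (x, h + k) = df (x, h) + df (x, k).
  apply: (dirderiv_unique hF (fdf x (h + k) Ux)).
  have sk := @strict_derivative _ _ _ _ _ _ k C1f Ux.
  have : (fun t : R => ((x + t *: h, k), t)) @ 0^' -->
    (filter_prod (nbhs (x, k)) (0 : R)^').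
    apply: (@cvg_pair _ _ _ _ (nbhs (x, k)) (0 : R)^'); last exact: cvg_id.
    by apply: (@cvg_pair _ _ _ _ (nbhs x) (nbhs k)); [exact: cvg_ray|exact: cvg_cst].
  move=> /cvg_comp/(_ sk) /= ck.
  rewrite /dirderiv; apply: cvg_trans (tvs_cvgD (fdf x h Ux) ck).
  apply: near_eq_cvg.
  near=> t => /=; rewrite -scalerDr [X in _ *: X = _]addrC subrKA.
  by rewrite -addrA -scalerDr.
have scalf a h : df (x, a *: h) = a *: df (x, h).
  have [->|a0] := eqVneq a 0.
    rewrite !scale0r; apply: (@addrI _ (df (x, 0))).
    by rewrite -addf !addr0.
  apply: (dirderiv_unique hF (fdf x (a *: h) Ux)).
  have am : (fun t : R => t * a) @ 0^' --> (0 : R)^'.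
    move=> A /dnbhs0P[e e0 eA]; apply/dnbhs0P; exists (e / `|a|).
      by rewrite divr_gt0 // normr_gt0.
    move=> t t0 te /=; apply: eA; first by rewrite mulf_neq0.
    by rewrite normrM -ltr_pdivlMr // normr_gt0.
  have ch := @cvg_comp _ _ _ (fun t : R => t * a) _ _ _ _ am (fdf x h Ux).
  rewrite /dirderiv; apply: cvg_trans (tvs_cvgZ (@cvg_cst _ a _ _ _) ch).
  apply: near_eq_cvg; near=> t => /=.
  by rewrite !scalerA invfM mulrCA divff // mulr1.
by move=> a h k; rewrite addf scalf.
Unshelve. all: by end_near. Qed.

Lemma C1_continuous E F (U : set E) (f : E -> F) df (x : E) :
  C1 U f df -> U x -> continuous (fun h => df (x, h)).
Proof.
move=> [oU fdf cdf] Ux h.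
have oUT : open (U `*` setT : set (E * E)).
  by apply: open_setX => //; exact: openT.
have UTx : (U `*` setT) (x, h) by split.
move: cdf; rewrite continuous_open_subspace // => /(_ (x, h) (mem_set UTx)) cx.
apply: (@cvg_comp _ _ _ (fun h => (x, h)) df _ (nbhs (x, h))) => //.
by apply: (@cvg_pair _ _ _ _ (nbhs x) (nbhs h)); [exact: cvg_cst|exact: cvg_id].
Qed.

Lemma dirderiv_id E (x h : E) : dirderiv (fun y : E => y) x h h.
Proof.
have : (fun t : R => h) @ 0^' --> h by exact: cvg_cst.
apply: cvg_trans; apply: near_eq_cvg; near=> t => /=.
rewrite [_ + t *: h]addrC addrK scalerA mulVf ?scale1r //.
by near: t; exact: nbhs_dnbhs_neq.
Unshelve. all: by end_near. Qed.

Arguments dirderiv_id {E} x h.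

Lemma dirderiv_linear E F G (i : F -> G) (g : E -> F) (x h : E) (l : F) :
  linear i -> continuous i -> dirderiv g x h l -> dirderiv (i \o g) x h (i l).
Proof.
move=> li ci gl.
have : (i \o (fun t : R => t^-1 *: (g (x + t *: h) - g x))) @ 0^' --> i l.
  by apply: (@cvg_comp _ _ _ _ i _ (nbhs l)) => //; exact: ci.
apply: cvg_trans; apply: near_eq_cvg; apply: nearW => t /=.
by rewrite (linear_funZ li) (linear_funB li).
Qed.

End Derivative.

Arguments dirderiv_id {R E} x h.

Section Smoothness.
Context {R : realType}.
Implicit Types E F G : tvsType R.

Lemma Ck_continuous k E F (U : set E) (f : E -> F) :
  Ck k U f -> {within U, continuous f}.
Proof. by case: k => [|k] //= []. Qed.

Lemma Ck_subset k E F (U V : set E) (f : E -> F) :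
  V `<=` U -> Ck k U f -> Ck k V f.
Proof.
elim: k E F U V f => [|k IH] E F U V f VU /=.
  exact: continuous_subspaceW.
move=> [cf [df [fdf Cdf]]]; split; first exact: continuous_subspaceW cf.
exists df; split; first by move=> x h /VU; exact: fdf.
by apply: IH Cdf => -[x h] [/= /VU Ux _].
Qed.

Lemma Ck_S k E F (U : set E) (f : E -> F) : Ck k.+1 U f -> Ck k U f.
Proof.
elim: k E F U f => [|k IH] E F U f; first by case.
move=> [cf [df [fdf Cdf]]]; split => //.
by exists df; split => //; apply: IH.
Qed.

Lemma within_eqon (S T : topologicalType) (U : set S) (f g : S -> T) :
  (forall x, U x -> f x = g x) -> {within U, continuous f} ->
  {within U, continuous g}.
Proof.
move=> fg; apply: subspace_eq_continuous => x /set_mem; exact: fg.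
Qed.

Lemma Ck_eqon k E F (U : set E) (f g : E -> F) :
  open U -> (forall x, U x -> f x = g x) -> Ck k U f -> Ck k U g.
Proof.
case: k => [|k] oU fg /=; first exact: within_eqon.
move=> [cf [df [fdf Cdf]]]; split; first exact: within_eqon cf.
exists df; split => // x h Ux.
exact: dirderiv_eqon oU fg Ux (fdf x h Ux).
Qed.

Lemma Ck_linear k E F (U : set E) (l : E -> F) :
  linear l -> continuous l -> Ck k U l.
Proof.
elim: k E F U l => [|k IH] E F U l ll cl /=; first exact: continuous_subspaceT.
split; first exact: continuous_subspaceT.
exists (fun p => l p.2); split.
  by move=> x h _; exact: dirderiv_linear ll cl (dirderiv_id x h).
apply: IH; first by move=> a p q /=; rewrite ll.
move=> p; apply: (@cvg_comp _ _ _ snd l _ (nbhs p.2)); [exact: cvg_snd|exact: cl].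
Qed.

Lemma Ck_fst k E F (U : set (E * F)) : Ck k U (@fst E F).
Proof. by apply: Ck_linear => [a p q //|p]; exact: cvg_fst. Qed.

Lemma Ck_snd k E F (U : set (E * F)) : Ck k U (@snd E F).
Proof. by apply: Ck_linear => [a p q //|p]; exact: cvg_snd. Qed.

Lemma Ck_id k E (U : set E) : Ck k U id.
Proof. by apply: Ck_linear => [a p q //|p]; exact: cvg_id. Qed.

Lemma Ck_cst k E F (U : set E) (c : F) : Ck k U (fun=> c).
Proof.
elim: k E F U c => [|k IH] E F U c /=.
  by apply: continuous_subspaceT => x; exact: cvg_cst.
split; first by apply: continuous_subspaceT => x; exact: cvg_cst.
exists (fun=> 0); split => // x h _; rewrite /dirderiv.
have -> : (fun t : R => t^-1 *: (c - c)) = fun=> (0 : F).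
  by apply/funext => t; rewrite subrr scaler0.
exact: cvg_cst.
Qed.

Lemma within_pair (S T T' : topologicalType) (U : set S) (f : S -> T)
    (g : S -> T') :
  {within U, continuous f} -> {within U, continuous g} ->
  {within U, continuous (fun x => (f x, g x))}.
Proof. by move=> cf cg x; apply: cvg_pair; [exact: cf|exact: cg]. Qed.

Lemma Ck_pair k E F G (U : set E) (f : E -> F) (g : E -> G) :
  Ck k U f -> Ck k U g -> Ck k U (fun x => (f x, g x)).
Proof.
elim: k E F G U f g => [|k IH] E F G U f g; first exact: within_pair.
move=> [cf [df [fdf Cdf]]] [cg [dg [gdg Cdg]]]; split; first exact: within_pair.
exists (fun p => (df p, dg p)); split; last exact: IH.
move=> x h Ux.
exact: (@cvg_pair _ _ _ _ (nbhs (df (x, h))) (nbhs (dg (x, h)))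
  _ _ _ _ _ (fdf x h Ux) (gdg x h Ux)).
Qed.

Lemma within_comp (S T T' : topologicalType) (U : set S) (V : set T)
    (f : S -> T) (g : T -> T') :
  (forall x, U x -> V (f x)) ->
  {within U, continuous f} -> {within V, continuous g} ->
  {within U, continuous (g \o f)}.
Proof.
move=> fUV /subspace_continuousP cf /subspace_continuousP cg.
apply/subspace_continuousP => x Ux N /(cg _ (fUV _ Ux)) /= gN.
have fN : \forall y \near x, U y -> V (f y) -> N (g (f y)) := cf _ Ux _ gN.
suff : \forall y \near x, U y -> N (g (f y)) by [].
by apply: filterS fN => y Ny Uy; apply: Ny => //; exact: fUV.
Qed.

Lemma Ck_C1 k E F (U : set E) (f : E -> F) : open U -> Ck k.+1 U f ->
  exists2 df, C1 U f df & Ck k (U `*` setT) df.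
Proof.
move=> oU [cf [df [fdf Cdf]]]; exists df => //; split => //.
exact: Ck_continuous Cdf.
Qed.

Lemma Ck_comp k E F G (U : set E) (V : set F) (f : E -> F) (g : F -> G) :
  open U -> open V -> (forall x, U x -> V (f x)) ->
  Ck k U f -> Ck k V g -> Ck k U (g \o f).
Proof.
elim: k E F G U V f g => [|k IH] E F G U V f g oU oV fUV.
  exact: within_comp.
move=> Cf Cg; split.
  by apply: within_comp fUV _ _; [case: Cf|case: Cg].
have [df C1f Cdf] := Ck_C1 oU Cf; have [dg C1g Cdg] := Ck_C1 oV Cg.
exists (dg \o (fun p => (f p.1, df p))); split.
  move=> x h Ux; apply: dirderiv_comp C1g (fUV _ Ux); case: C1f => _ fdf _.
  exact: fdf.
have oUT : open (U `*` setT : set (E * E)) by apply: open_setX => //; exact: openT.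
have oVT : open (V `*` setT : set (F * F)) by apply: open_setX => //; exact: openT.
have IHc := IH; apply: IHc (Cdg) => //; first by move=> [x h] [/= Ux _]; split => //=; exact: fUV.
apply: Ck_pair => //.
apply: (IH _ _ _ _ U fst f oUT oU) => //; last exact: Ck_S.
  by move=> [x h] [].
exact: Ck_fst.
Qed.

(** Being Hausdorff makes the local derivatives agree, so they glue. *)
Lemma Ck_local k E F (U : set E) (f : E -> F) : hausdorff_space F -> open U ->
  (forall x, U x -> exists V, [/\ open V, V x & Ck k (U `&` V) f]) -> Ck k U f.
Proof.
elim: k E F U f => [|k IH] E F U f hF oU loc.
  rewrite /= continuous_open_subspace // => x /set_mem Ux.
  have [V [oV Vx]] := loc x Ux; rewrite /= continuous_open_subspace; last exact: openI.
  by apply; apply: mem_set.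
split.
  rewrite continuous_open_subspace // => x /set_mem Ux.
  have [V [oV Vx /Ck_continuous]] := loc x Ux.
  rewrite /= continuous_open_subspace; last exact: openI.
  by apply; apply: mem_set.
have [df dfP] : exists df : E * E -> F, forall x h, U x -> dirderiv f x h (df (x, h)).
  have [df dfP] : {df : E * E -> F & forall p, U p.1 -> dirderiv f p.1 p.2 (df p)}.
    apply: (@choice _ _ (fun p l => U p.1 -> dirderiv f p.1 p.2 l)) => -[x h] /=.
    have [Ux|] := pselect (U x); last by exists 0.
    have [V [oV Vx [cf [df [fdf _]]]]] := loc x Ux.
    by exists (df (x, h)) => _; exact: fdf.
  by exists df => x h Ux; exact: (dfP (x, h)).
exists df; split => //; apply: IH => //.
  by apply: open_setX => //; exact: openT.
move=> [x h] [/= Ux _]; have [V [oV Vx [cf [dg [fdg Cdg]]]]] := loc x Ux.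
exists (V `*` setT); split => //; first by apply: open_setX => //; exact: openT.
apply: (@Ck_eqon _ _ _ _ dg).
- by apply: openI; apply: open_setX => //; exact: openT.
- move=> [y e] [[/= Uy _] [/= Vy _]].
  by apply: (dirderiv_unique hF (fdg y e _) (dfP y e Uy)).
- by apply: Ck_subset Cdg => -[y e] [[/= Uy _] [/= Vy _]].
Qed.

Lemma embedding_range_closed E F (i : E -> F) :
  closed_linear_embedding i -> closed (range i).
Proof. by case=> _ _ _ ci; apply: ci; exact: closedT. Qed.

(** A closed embedding is a homeomorphism onto its range. *)
Lemma embedding_cvg E F (i : E -> F) (I : Type) (FF : set_system I)
    {fFF : Filter FF} (g : I -> E) (l : E) : closed_linear_embedding i ->
  (i \o g) @ FF --> i l -> g @ FF --> l.
Proof.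
move=> [il ii ic icl] gl N /= lN; move: lN; rewrite nbhsE => -[W [oW Wl] WN].
have cO : closed (i @` (~` W)) by apply: icl; exact: open_closedC.
have nO : (~` (i @` (~` W))) (i l) by move=> [y Oy /ii ly]; apply: Oy; rewrite ly.
have gW : FF ((i \o g) @^-1` (~` (i @` (~` W)))).
  exact: gl _ (open_nbhs_nbhs (conj (closed_openC cO) nO)).
suff : FF (g @^-1` N) by [].
apply: filterS gW => x /= nx; apply: WN; apply: contrapT => Ox; apply: nx.
by exists (g x).
Qed.

(** The difference quotients lie in the range of [i], which is closed. *)
Lemma dirderiv_embedding E F G (i : F -> G) (g : E -> F) (x h : E) (l : G) :
  closed_linear_embedding i -> dirderiv (i \o g) x h l ->
  exists2 l', i l' = l & dirderiv g x h l'.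
Proof.
move=> ie gl; have [il ii ic icl] := ie.
have igE (t : R) : t^-1 *: ((i \o g) (x + t *: h) - (i \o g) x) =
    i (t^-1 *: (g (x + t *: h) - g x)).
  by rewrite (linear_funZ il) (linear_funB il).
have [l' _ il'] : range i l.
  apply: (closed_cvg _ (embedding_range_closed ie) _ _ gl).
  by apply: nearW => t /=; rewrite igE; exists (t^-1 *: (g (x + t *: h) - g x)).
exists l' => //; apply: (embedding_cvg ie); rewrite il'.
apply: cvg_trans gl; apply: near_eq_cvg; apply: nearW => t /=.
by rewrite -igE.
Qed.

(** By induction, since the derivative of [i \o g] is again [i \o dg]. *)
Lemma Ck_embedding k E F G (U : set E) (i : F -> G) (g : E -> F) :
  closed_linear_embedding i -> open U -> Ck k U (i \o g) -> Ck k U g.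
Proof.
move=> ie; elim: k E U g => [|k IH] E U g oU.
  move=> /= /subspace_continuousP cg; apply/subspace_continuousP => x Ux.
  by apply: (embedding_cvg ie); exact: cg.
have cl := ie; move=> [cg [df [fdf Cdf]]]; split.
  move: cg => /subspace_continuousP cg; apply/subspace_continuousP => x Ux.
  by apply: (embedding_cvg ie); exact: cg.
have [dg dgP] : {dg : E * E -> F & forall p, U p.1 ->
    i (dg p) = df p /\ dirderiv g p.1 p.2 (dg p)}.
  apply: (@choice _ _ (fun p l => U p.1 -> i l = df p /\ dirderiv g p.1 p.2 l)).
  move=> [x h] /=; have [Ux|] := pselect (U x); last by exists 0.
  by have [l il gl] := dirderiv_embedding ie (fdf x h Ux); exists l.
exists dg; split; first by move=> x h Ux; case: (dgP (x, h) Ux).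
have oUT : open (U `*` setT : set (E * E)) by apply: open_setX => //; exact: openT.
apply: IH => //; apply: Ck_eqon Cdf => // -[x h] [/= Ux _].
by case: (dgP (x, h) Ux).
Qed.

End Smoothness.

(** * Relative topologies *)

Section TopologyOnSubsets.
Implicit Types S T U : topologicalType.

Lemma nbhs_subspace_within T (A : set T) (x : T) : A x ->
  nbhs (x : subspace A) = within A (nbhs x).
Proof. by move=> Ax; case: (nbhs_subspaceP A x). Qed.

(** Separation by open sets of [T] itself: in this form it passes at once to
    subsets of [A] and to products ([hausdorff_onP] returns to the relative
    topology). *)
Definition hausdorff_on T (A : set T) := forall p q, A p -> A q ->
  (forall V W, open V -> open W -> V p -> W q ->
     exists z, [/\ A z, V z & W z]) -> p = q.

Lemma hausdorff_onP T (A : set T) :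
  hausdorff_space (subspace A) <-> hausdorff_on A.
Proof.
split=> [hA p q Ap Aq pq|hA p q pq].
  apply: hA => V W.
  rewrite !nbhs_subspace_within // /within /= !nbhsE => -[V' [oV' Vp] VV] [W' [oW' Wq] WW].
  have [z [Az Vz Wz]] := pq V' W' oV' oW' Vp Wq.
  by exists z; split; [exact: VV|exact: WW].
have sing (r : T) : ~ A r -> nbhs (r : subspace A) [set r].
  by move=> nAr; case: (nbhs_subspaceP A r) => // _ z.
have [Ap|nAp] := pselect (A p); last first.
  have [Aq|nAq] := pselect (A q); last first.
    by have [z [-> ->]] := pq _ _ (sing _ nAp) (sing _ nAq).
  have nA : nbhs (q : subspace A) A.
    by rewrite nbhs_subspace_within //; exact: withinT.
  by have [z [zp Az]] := pq _ _ (sing _ nAp) nA; move: Az; rewrite zp => /nAp.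
have nAp : nbhs (p : subspace A) A.
  by rewrite nbhs_subspace_within //; exact: withinT.
have [Aq|nAq] := pselect (A q); last first.
  by have [z [Az zq]] := pq _ _ nAp (sing _ nAq); move: Az; rewrite zq => /nAq.
apply: hA => // V W oV oW Vp Wq.
have nV : nbhs (p : subspace A) (A `&` V).
  rewrite nbhs_subspace_within //; apply: filterI; first exact: withinT.
  have n0 : nbhs (p : T) V by apply: open_nbhs_nbhs.
  by apply: (@filterS _ _ _ _ _ _ n0) => z Vz _.
have nW : nbhs (q : subspace A) (A `&` W).
  rewrite nbhs_subspace_within //; apply: filterI; first exact: withinT.
  have n0 : nbhs (q : T) W by apply: open_nbhs_nbhs.
  by apply: (@filterS _ _ _ _ _ _ n0) => z Vz _.
by have [z [[Az Vz] [_ Wz]]] := pq _ _ nV nW; exists z.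
Qed.

Lemma hausdorff_onT T : hausdorff_on (@setT T) <-> hausdorff_space T.
Proof.
split=> [hT p q pq|hT p q _ _ pq].
  apply: hT => // V W oV oW Vp Wq.
  have [z [Vz Wz]] := pq _ _ (open_nbhs_nbhs (conj oV Vp)) (open_nbhs_nbhs (conj oW Wq)).
  by exists z.
apply: hT => V W; rewrite !nbhsE => -[V' [oV' Vp] VV] [W' [oW' Wq] WW].
have [z [_ Vz Wz]] := pq V' W' oV' oW' Vp Wq.
by exists z; split; [exact: VV|exact: WW].
Qed.

Lemma hausdorff_onS T (A B : set T) :
  A `<=` B -> hausdorff_on B -> hausdorff_on A.
Proof.
move=> AB hB p q /AB Bp /AB Bq pq; apply: hB => // V W oV oW Vp Wq.
by have [z [/AB Bz Vz Wz]] := pq V W oV oW Vp Wq; exists z.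
Qed.

Lemma hausdorff_on_prod T U (A : set T) (B : set U) :
  hausdorff_on A -> hausdorff_on B -> hausdorff_on (A `*` B).
Proof.
move=> hA hB [p1 p2] [q1 q2] [/= Ap Bp] [/= Aq Bq] pq; congr pair.
  apply: hA => // V W oV oW Vp Wq.
  have [|||//|z [[/= Az Bz] [/= Vz _] [/= Wz _]]] := pq (V `*` setT) (W `*` setT) => //.
  - by apply: open_setX => //; exact: openT.
  - by apply: open_setX => //; exact: openT.
  by exists z.1.
apply: hB => // V W oV oW Vp Wq.
have [|||//|z [[/= Az Bz] [/= _ Vz] [/= _ Wz]]] := pq (setT `*` V) (setT `*` W) => //.
- by apply: open_setX => //; exact: openT.
- by apply: open_setX => //; exact: openT.
by exists z.2.
Qed.

Lemma hausdorff_prod T U : hausdorff_space T -> hausdorff_space U ->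
  hausdorff_space (T * U)%type.
Proof.
move=> /hausdorff_onT hT /hausdorff_onT hU; apply/hausdorff_onT.
by have := hausdorff_on_prod hT hU; rewrite setXTT.
Qed.

Lemma hausdorff_injective T U (f : T -> U) :
  injective f -> continuous f -> hausdorff_space U -> hausdorff_space T.
Proof.
move=> fi fc hU p q pq; apply: fi; apply: hU => V W /fc nV /fc nW.
by have [z [Vz Wz]] := pq _ _ nV nW; exists (f z).
Qed.

Lemma within_preimage_open S T (P : set S) (A V : set T) (f : S -> T) :
  open P -> {within P, continuous f} -> (forall x, P x -> A (f x)) ->
  rel_open A V -> open (P `&` f @^-1` V).
Proof.
move=> oP; rewrite continuous_open_subspace // => /(continuous_inP _ oP) cf fA.
move=> [W oW ->]; have := cf W oW; congr open; apply/seteqP; split => x [Px Wx].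
  by split => //; split => //; exact: fA.
by split => //; case: Wx.
Qed.

Lemma within_preimage_rel_open S T (P : set S) (A V : set T) (f : S -> T) :
  {within P, continuous f} -> (forall x, P x -> A (f x)) ->
  rel_open A V -> rel_open P (P `&` f @^-1` V).
Proof.
move=> /continuousP cf fA [W oW ->].
have /open_subspaceP[N oN NE] := cf W oW.
exists N => //; rewrite setIC [in RHS]setIC NE; apply/seteqP; split => x [].
  by move=> [Ax Wx] Px.
by move=> Wx Px; split => //; split => //; exact: fA.
Qed.

Lemma rel_open_trans T (A B C : set T) :
  rel_open A B -> rel_open B C -> rel_open A C.
Proof.
by move=> [V oV ->] [W oW ->]; exists (V `&` W); rewrite ?setIA //; exact: openI.
Qed.

Lemma rel_openI T (A B C : set T) :
  rel_open A B -> rel_open A C -> rel_open A (B `&` C).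
Proof.
move=> [V oV ->] [W oW ->]; exists (V `&` W); first exact: openI.
by rewrite setIACA setIid.
Qed.

Lemma rel_open_sub T (A B : set T) : rel_open A B -> B `<=` A.
Proof. by move=> [V _ ->] x []. Qed.

Lemma rel_openX T U (A V : set T) (B W : set U) :
  rel_open A V -> rel_open B W -> rel_open (A `*` B) (V `*` W).
Proof.
move=> [V' oV ->] [W' oW ->]; exists (V' `*` W'); first exact: open_setX.
by apply/seteqP; split => -[x y] /= [[? ?] [? ?]].
Qed.

End TopologyOnSubsets.

(** * Smooth maps in charts *)

Section Atlases.
Context {R : realType}.
Implicit Types (S T U : topologicalType).

Section IsChart.
Context (T : topologicalType) (A : set T) (c : chart R T).
Hypothesis cA : is_chart A c.

Lemma chart_hausdorff : hausdorff_space (model c). Proof. by case: cA => -[]. Qed.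
Lemma chart_rel_open : rel_open A (dom c). Proof. by case: cA => -[]. Qed.
Lemma chart_open : open (cod c). Proof. by case: cA => -[]. Qed.
Lemma chart_sub : dom c `<=` A. Proof. exact: rel_open_sub chart_rel_open. Qed.
Lemma chart_coord x : dom c x -> cod c (coord c x).
Proof. by case: cA => _ [[+ _ _ _] _]; exact. Qed.
Lemma chart_param y : cod c y -> dom c (param c y).
Proof. by case: cA => _ [[_ + _ _] _]; exact. Qed.
Lemma coordK x : dom c x -> param c (coord c x) = x.
Proof. by case: cA => _ [[_ _ cK _] _] /mem_set; exact: cK. Qed.
Lemma paramK y : cod c y -> coord c (param c y) = y.
Proof. by case: cA => _ [[_ _ _ pK] _] /mem_set; exact: pK. Qed.
Lemma coord_continuous : {within dom c, continuous coord c}.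
Proof. by case: cA => _ [_ []]. Qed.
Lemma param_continuous : {within cod c, continuous param c}.
Proof. by case: cA => _ [_ []]. Qed.
End IsChart.

(** The largest set on which the local representative [rep c d f] makes sense. *)
Definition repdom T U (c : chart R T) (d : chart R U) (f : T -> U) :=
  cod c `&` (f \o param c) @^-1` dom d.

Definition rep T U (c : chart R T) (d : chart R U) (f : T -> U) :=
  coord d \o f \o param c.

Arguments repdom {T U} c d f.
Arguments rep {T U} c d f.

Lemma repdom_open T U (A : set T) (B : set U) c d f :
  is_chart A c -> is_chart B d -> (forall x, A x -> B (f x)) ->
  {within A, continuous f} -> open (repdom c d f).
Proof.
move=> cA dB fAB cf; apply: (@within_preimage_open _ _ _ B) (chart_rel_open dB).
- exact: chart_open cA.
- apply: within_comp (param_continuous cA) cf => y /(chart_param cA).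
  exact: chart_sub.
- by move=> y /(chart_param cA)/(chart_sub cA); exact: fAB.
Qed.

Lemma manifold_chart T (X : smooth_space R T) : manifold X -> forall c,
  atlas X c -> compatible_chart X c.
Proof. by case. Qed.

Lemma manifold_cover T (X : smooth_space R T) : manifold X -> forall x,
  carrier X x -> exists2 c, atlas X c & dom c x.
Proof. by case. Qed.

(** Locally the representative factors through charts of the given atlases. *)
Lemma smooth_map_rep T U (X : smooth_space R T) (Y : smooth_space R U) f c d :
  manifold X -> manifold Y -> smooth_map X Y f ->
  compatible_chart X c -> compatible_chart Y d ->
  smooth (repdom c d f) (rep c d f).
Proof.
move=> mX mY [fXY cf fs] [cX cs] [dY ds] k.
have oD := repdom_open cX dY fXY cf.
apply: Ck_local => //; first exact: chart_hausdorff dY.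
move=> y [cy dy].
have Xy := chart_sub cX (chart_param cX cy).
have [c0 c0X c0y] := manifold_cover mX Xy.
have [d0 d0Y d0y] := manifold_cover mY (fXY _ Xy).
have [c0c _] := manifold_chart mX c0X; have [d0c _] := manifold_chart mY d0Y.
have idc (A : set T) : {within A, continuous (@id T)}.
  by apply: continuous_subspaceT => ?; exact: cvg_id.
have idcU (A : set U) : {within A, continuous (@id U)}.
  by apply: continuous_subspaceT => ?; exact: cvg_id.
have oc : open (repdom c c0 id) by apply: (repdom_open cX c0c).
have od : open (repdom d0 d id) by apply: (repdom_open d0c dY).
have ocd : open (repdom c d0 f) by apply: (repdom_open cX d0c).
have o0 : open (repdom c0 d0 f) by apply: (repdom_open c0c d0c).
exists (repdom c c0 id `&` repdom c d0 f); split => //; first exact: openI.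
have oW : open (repdom c d f `&` (repdom c c0 id `&` repdom c d0 f)).
  by apply: openI => //; exact: openI.
apply: (@Ck_eqon _ _ _ _ _
  (rep d0 d id \o (rep c0 d0 f \o rep c c0 id))) => //.
  move=> z [[cz dz] [[_ /= c0z] [_ /= d0z]]]; rewrite /rep /=.
  by rewrite (coordK c0c) // (coordK d0c).
have c0z z : repdom c c0 id z -> repdom c d0 f z -> repdom c0 d0 f (rep c c0 id z).
  move=> [_ /= c0z] [_ /= d0z]; split; first exact: (chart_coord c0c).
  by rewrite /= /rep /= (coordK c0c).
apply: (@Ck_comp _ _ _ _ _ _ (repdom d0 d id)) => //.
- move=> z [[cz dz] [[_ /= c0z'] [_ /= d0z]]]; rewrite /rep /=.
  split; first by apply: (chart_coord d0c); rewrite (coordK c0c).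
  by rewrite /= (coordK c0c) // (coordK d0c).
- apply: (@Ck_comp _ _ _ _ _ _ (repdom c0 d0 f)) => //.
  + by move=> z [_ [? ?]]; exact: c0z.
  + apply: Ck_subset ((cs _ c0X).1 k); by move=> z [_ [[? ?] _]].
  + exact: fs.
- exact: (ds _ d0Y).2.
Qed.

(** One pair of charts around each point is enough: the transition maps to the
    charts of the atlases are smooth. *)
Lemma smooth_map_local T U (X : smooth_space R T) (Y : smooth_space R U) f :
  manifold X -> manifold Y ->
  (forall x, carrier X x -> carrier Y (f x)) ->
  {within carrier X, continuous f} ->
  (forall x, carrier X x -> exists c d W,
     [/\ compatible_chart X c, compatible_chart Y d, dom c x
       & [/\ open W, W (coord c x), W `<=` repdom c d f
           & smooth W (rep c d f)]]) ->
  smooth_map X Y f.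
Proof.
move=> mX mY fXY cf loc; split => // c0 d0 c0X d0Y k.
have c0c := (manifold_chart mX c0X).1; have d0c := (manifold_chart mY d0Y).1.
apply: Ck_local.
- exact: chart_hausdorff d0c.
- exact: repdom_open c0c d0c fXY cf.
move=> y [c0y d0y].
have Xy := chart_sub c0c (chart_param c0c c0y).
have [c [d [W [[cX cs] [dY ds] cy [oW Wy WD sW]]]]] := loc _ Xy.
have [_ dy] := WD _ Wy.
have idc (A : set T) : {within A, continuous (@id T)}.
  by apply: continuous_subspaceT => ?; exact: cvg_id.
have idcU (A : set U) : {within A, continuous (@id U)}.
  by apply: continuous_subspaceT => ?; exact: cvg_id.
have oc : open (repdom c0 c id) by apply: (repdom_open c0c cX).
have od : open (repdom d d0 id) by apply: (repdom_open dY d0c).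
have ocW : open (repdom c0 c id `&` rep c0 c id @^-1` W).
  have sc : {within repdom c0 c id, continuous (rep c0 c id)}.
    exact: Ck_continuous ((cs _ c0X).2 0%N).
  apply: (@within_preimage_open _ _ _ setT) => //.
  by exists W => //; rewrite setTI.
exists (repdom c0 c id `&` rep c0 c id @^-1` W); split => //.
set N := (X in Ck _ X _).
have oN : open N by apply: openI => //; apply: repdom_open c0c d0c fXY cf.
have fz z : N z -> f (param c (rep c0 c id z)) = f (param c0 z).
  by move=> [_ [[_ /= cz] _]]; rewrite /rep /= (coordK cX).
have dz z : N z -> dom d (f (param c0 z)).
  by move=> Nz; rewrite -fz //; case: Nz => _ [_ /WD[_]].
apply: (@Ck_eqon _ _ _ _ _
  (rep d d0 id \o (rep c d f \o rep c0 c id))) => //.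
  by move=> z Nz; have := fz z Nz; rewrite /rep /= => ->; rewrite (coordK dY) //; exact: dz.
apply: (@Ck_comp _ _ _ _ _ _ (repdom d d0 id)) => //.
- move=> z Nz; have := fz z Nz; rewrite /rep /= => ->.
  split; first by apply: (chart_coord dY); exact: dz.
  by rewrite /= (coordK dY); [case: Nz => -[]|exact: dz].
- apply: (@Ck_comp _ _ _ _ _ _ W) => //.
  + by move=> z [_ []].
  + by apply: Ck_subset ((cs _ c0X).2 k) => z [_ []].
- exact: (ds _ d0Y).1.
Qed.

Lemma smooth_map_id T (X : smooth_space R T) : manifold X -> smooth_map X X id.
Proof.
move=> mX; split => //.
  by apply: continuous_subspaceT => ?; exact: cvg_id.
by move=> c d cX dX; exact: ((manifold_chart mX cX).2 _ dX).1.
Qed.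

Lemma smooth_map_comp T U (V : topologicalType) (X : smooth_space R T) (Y : smooth_space R U)
    (Z : smooth_space R V) f g :
  manifold X -> manifold Y -> manifold Z ->
  smooth_map X Y f -> smooth_map Y Z g -> smooth_map X Z (g \o f).
Proof.
move=> mX mY mZ sf sg; have [fXY cf fs] := sf; have [gYZ cg gs] := sg.
apply: smooth_map_local => //.
- by move=> x /fXY/gYZ.
- exact: within_comp fXY cf cg.
move=> x Xx; have [c cX cx] := manifold_cover mX Xx.
have [d dY dx] := manifold_cover mY (fXY _ Xx).
have [e eZ ex] := manifold_cover mZ (gYZ _ (fXY _ Xx)).
have cc := manifold_chart mX cX; have dc := manifold_chart mY dY.
have ec := manifold_chart mZ eZ.
have ocd := repdom_open cc.1 dc.1 fXY cf.
have cgf : {within carrier X, continuous (g \o f)} by exact: within_comp fXY cf cg.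
have oce : open (repdom c e (g \o f)).
  by apply: repdom_open cc.1 ec.1 _ cgf => z /fXY/gYZ.
have ode := repdom_open dc.1 ec.1 gYZ cg.
exists c, e, (repdom c d f `&` repdom c e (g \o f)); split => //; split.
- exact: openI.
- split; split => /=; rewrite ?(coordK cc.1) //; exact: (chart_coord cc.1 cx).
- by move=> z [].
move=> k; apply: (@Ck_eqon _ _ _ _ _ (rep d e g \o rep c d f)).
- exact: openI.
- by move=> z [[_ /= dz] _]; rewrite /rep /= (coordK dc.1).
apply: (@Ck_comp _ _ _ _ _ _ (repdom d e g)) => //.
- exact: openI.
- move=> z [[_ /= dz] [_ /= ez]]; split; first exact: (chart_coord dc.1 dz).
  by rewrite /rep /= (coordK dc.1).
- by apply: Ck_subset (fs _ _ cX dY k) => z [].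
- exact: gs.
Qed.

End Atlases.

Arguments repdom {R T U} c d f.
Arguments rep {R T U} c d f.

(** * Submanifolds *)

Section Submanifolds.
Context {R : realType}.
Implicit Types (S T U : topologicalType).

Lemma within_id T (A : set T) : {within A, continuous (@id T)}.
Proof. by apply: continuous_subspaceT => ?; exact: cvg_id. Qed.

(** The coordinates in [c'] are those in [c], read through the closed embedding
    of the model spaces, which reflects continuity. *)
Lemma sub_chart_is_chart T (X : smooth_space R T) A c' :
  A `<=` carrier X -> sub_chart X A c' -> is_chart A c'.
Proof.
move=> AX [c [i [[[cX _] ie cA] [dE oE iE pE]]]].
have [il ii ic icl] := ie.
have cK x : dom c' x -> i (coord c' x) = coord c x by move=> dx; apply: iE; exact: mem_set.
have pK y : cod c' y -> param c' y = param c (i y) by move=> dy; apply: pE; exact: mem_set.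
have ran y : cod c' y -> exists2 x, dom c' x & coord c x = i y.
  rewrite oE => cy.
  have : (cod c `&` range i) (i y) by split => //; exists y.
  by rewrite -cA -dE => -[x dx xE]; exists x.
have domc x : dom c' x -> dom c x by rewrite dE => -[].
split; [split|split; [split|split]].
- exact: hausdorff_injective ii ic (chart_hausdorff cX).
- rewrite dE; case: (chart_rel_open cX) => W oW ->; exists W => //.
  by apply/seteqP; split => x [] => [[Xx Wx] Ax|Ax Wx] //; split => //; split => //; exact: AX.
- by rewrite oE; move: ic => /continuousP; apply; exact: chart_open cX.
- by move=> x dx; rewrite oE /preimage /= cK //; exact: (chart_coord cX (domc _ dx)).
- move=> y cy; have [x dx xE] := ran y cy.
  by rewrite pK // -xE (coordK cX) //; exact: domc.
- move=> x /set_mem dx; rewrite pK ?cK //; first by rewrite (coordK cX) //; exact: domc.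
  by rewrite oE /preimage /= cK //; exact: (chart_coord cX (domc _ dx)).
- move=> y /set_mem cy; apply: ii; have [x dx xE] := ran y cy.
  by rewrite pK // -xE (coordK cX (domc _ dx)) -cK.
- apply/subspace_continuousP => x dx; apply: (embedding_cvg ie).
  have : {within dom c', continuous (i \o coord c')}.
    apply: (@within_eqon _ _ _ (coord c)) => [z dz|]; first by rewrite /= cK.
    by apply: continuous_subspaceW (coord_continuous cX); exact: domc.
  by move=> /subspace_continuousP; apply.
- apply: (@within_eqon _ _ _ (param c \o i)) => [z dz|]; first by rewrite /= pK.
  apply: (@within_comp _ _ _ _ (cod c)) (param_continuous cX).
    by move=> y; rewrite oE.
  exact: continuous_subspaceT.
Qed.

(** The embedding of the model spaces reflects smoothness ([Ck_embedding]). *)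
Lemma smooth_into_sub_chart T U (X : smooth_space R T) (Y : smooth_space R U)
    (A : set U) c d' f : manifold X -> manifold Y ->
  A `<=` carrier Y -> (forall x, carrier X x -> A (f x)) ->
  smooth_map X Y f -> compatible_chart X c -> sub_chart Y A d' ->
  smooth (repdom c d' f) (rep c d' f).
Proof.
move=> mX mY AY fA sf cX sd k; have d'c := sub_chart_is_chart AY sd.
have [fXY cf fs] := sf.
have od := repdom_open cX.1 d'c fA cf.
move: sd => [d [i [[dY ie dA] [dE oE iE pE]]]].
apply: (Ck_embedding ie) => //.
apply: (@Ck_eqon _ _ _ _ _ (rep c d f)) => //.
  by move=> x [cx dx]; rewrite /rep /= -[LHS](iE _ (mem_set dx)).
apply: Ck_subset (smooth_map_rep mX mY sf cX dY k) => x [cx] /=.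
by rewrite dE => -[].
Qed.

Lemma smooth_from_sub_chart T U (X : smooth_space R T) (Y : smooth_space R U)
    (A : set T) c' d f : manifold X -> manifold Y ->
  A `<=` carrier X -> smooth_map X Y f -> sub_chart X A c' ->
  compatible_chart Y d ->
  smooth (repdom c' d f) (rep c' d f).
Proof.
move=> mX mY AX sf sc dY k; have c'c := sub_chart_is_chart AX sc.
have [fXY cf fs] := sf.
have oc : open (repdom c' d f).
  apply: (repdom_open c'c dY.1); first by move=> x /AX; exact: fXY.
  exact: continuous_subspaceW cf.
move: sc => [c [i [[cX ie cA] [dE oE iE pE]]]]; have [il ii ic icl] := ie.
have pE' y : cod c' y -> param c' y = param c (i y) by move=> cy; apply: pE; exact: mem_set.
apply: (@Ck_eqon _ _ _ _ _ (rep c d f \o i)) => //.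
  by move=> y [cy _]; rewrite /rep /= pE'.
apply: (@Ck_comp _ _ _ _ _ _ (repdom c d f)) => //.
- exact: repdom_open cX.1 dY.1 fXY cf.
- by move=> y [cy /= dy]; split; [move: cy; rewrite oE|rewrite /= -pE'].
- exact: Ck_linear.
- exact: smooth_map_rep sf cX dY k.
Qed.

Lemma sub_chart_compatible T (X : smooth_space R T) A c' :
  manifold X -> submanifold X A -> sub_chart X A c' ->
  compatible_chart (sub_space X A) c'.
Proof.
move=> mX [AX _] sc'; split; first exact: sub_chart_is_chart AX sc'.
have trans c d : sub_chart X A c -> sub_chart X A d -> smooth_transition c d.
  move=> sc sd k; have cc := sub_chart_is_chart AX sc.
  have dc := sub_chart_is_chart AX sd.
  have oD : open (repdom c d id) by apply: (repdom_open cc dc) => //; exact: within_id.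
  move: (sd) => [e [i [[eX ie eA] [dE oE iE pE]]]].
  apply: (Ck_embedding ie) => //.
  apply: (@Ck_eqon _ _ _ _ _ (rep c e id)) => //.
    by move=> x [cx dx]; rewrite /rep /= -[LHS](iE _ (mem_set dx)).
  have := smooth_from_sub_chart mX mX AX (smooth_map_id mX) sc eX.
  by move=> /(_ k); apply: Ck_subset => x [cx] /=; rewrite dE => -[].
by move=> d sd; split; exact: trans.
Qed.

Lemma sub_space_manifold T (X : smooth_space R T) A :
  manifold X -> submanifold X A -> manifold (sub_space X A).
Proof.
move=> mX sA; split.
- apply/hausdorff_onP; apply: hausdorff_onS (sA.1) _.
  by apply/hausdorff_onP; case: mX.
- exact: sA.2.
- by move=> c; exact: sub_chart_compatible.
Qed.

Lemma smooth_incl T (X : smooth_space R T) A :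
  manifold X -> submanifold X A -> smooth_map (sub_space X A) X id.
Proof.
move=> mX sA; split; [exact: sA.1|exact: within_id|].
move=> c d sc dX; apply: (smooth_from_sub_chart mX mX sA.1) => //.
  exact: smooth_map_id.
exact: manifold_chart.
Qed.

Lemma smooth_map_into T U (X : smooth_space R T) (Y : smooth_space R U) A f :
  manifold X -> manifold Y -> submanifold Y A ->
  (forall x, carrier X x -> A (f x)) -> smooth_map X Y f ->
  smooth_map X (sub_space Y A) f.
Proof.
move=> mX mY sA fA sf; have [_ cf _] := sf; split => //.
move=> c d cX sd; apply: (smooth_into_sub_chart mX mY sA.1) => //.
exact: manifold_chart.
Qed.

Lemma smooth_map_restrict T U (X : smooth_space R T) (Y : smooth_space R U) A f :
  manifold X -> manifold Y -> submanifold X A -> smooth_map X Y f ->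
  smooth_map (sub_space X A) Y f.
Proof.
move=> mX mY sA sf.
exact: (smooth_map_comp (sub_space_manifold mX sA) mX mY (smooth_incl mX sA) sf).
Qed.

Definition restrict_chart T (c : chart R T) (W : set T) : chart R T :=
  Chart (model c) (dom c `&` W) (cod c `&` param c @^-1` W) (coord c) (param c).

Lemma restrict_is_chart T (A W : set T) c :
  is_chart A c -> rel_open A W -> is_chart A (restrict_chart c W).
Proof.
move=> cA oW; split; [split|split; [split|split]] => /=.
- exact: chart_hausdorff cA.
- exact: rel_openI (chart_rel_open cA) oW.
- apply: (@within_preimage_open _ _ _ A) => //.
  + exact: chart_open cA.
  + exact: param_continuous cA.
  + by move=> y /(chart_param cA)/(chart_sub cA).
- move=> x [cx Wx]; split; first exact: (chart_coord cA).
  by rewrite /preimage /= (coordK cA).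
- by move=> y [cy Wy]; split => //; exact: (chart_param cA).
- by move=> x /set_mem[cx _]; exact: (coordK cA).
- by move=> x /set_mem[cx _]; exact: (paramK cA).
- by apply: continuous_subspaceW (coord_continuous cA) => x [].
- by apply: continuous_subspaceW (param_continuous cA) => x [].
Qed.

Lemma restrict_compatible T (X : smooth_space R T) c W :
  rel_open (carrier X) W -> compatible_chart X c ->
  compatible_chart X (restrict_chart c W).
Proof.
move=> oW [cX cs]; split; first exact: restrict_is_chart.
move=> d dX; have [cd dc] := cs d dX; split => k.
  by apply: Ck_subset (cd k) => y [[]].
by apply: Ck_subset (dc k) => y [? [? ?]].
Qed.

(** An open subset looks like the whole model space, which is a closed subspace
    of itself. *)
Lemma restrict_sub_chart T (X : smooth_space R T) c W :
  rel_open (carrier X) W -> compatible_chart X c ->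
  sub_chart X W (restrict_chart c W).
Proof.
move=> oW cX; exists (restrict_chart c W), id; split; split => //.
- exact: restrict_compatible.
- split=> // [x|C cC]; [exact: cvg_id|by rewrite image_id].
- have cW := restrict_is_chart cX.1 oW.
  apply/seteqP; split => y.
    by move=> [x [dx Wx] <-]; split; [exact: (chart_coord cW)|exists (coord c x)].
  move=> [cy _]; exists (param c y); last by rewrite (paramK cW).
  by have := chart_param cW cy => -[].
- by rewrite /= -setIA setIid.
Qed.

Lemma open_submanifold T (X : smooth_space R T) W :
  manifold X -> rel_open (carrier X) W -> submanifold X W.
Proof.
move=> mX oW; split; first exact: rel_open_sub oW.
move=> x Wx; have [c cX cx] := manifold_cover mX (rel_open_sub oW Wx).
exists (restrict_chart c W) => //; apply: restrict_sub_chart => //.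
exact: manifold_chart.
Qed.

Lemma open_sub_space_compatible T (X : smooth_space R T) W c :
  manifold X -> rel_open (carrier X) W ->
  compatible_chart (sub_space X W) c -> compatible_chart X c.
Proof.
move=> mX oW [cW cs]; split.
  case: cW => -[h o oc] [b ct]; split => //; split => //.
  exact: rel_open_trans oW o.
move=> d dX; have [cd dc] := cs _ (restrict_sub_chart oW (manifold_chart mX dX)).
split=> k.
  apply: Ck_subset (cd k) => y [cy /= dy]; split => //; split => //.
  exact: chart_sub (chart_param cW cy).
apply: Ck_subset (dc k) => y [dy /= cy]; split => //; split => //.
exact: chart_sub cW _ cy.
Qed.

(** Near each of its points [A] is closed in the domain of a chart, because the
    subspace is closed in the model space; the union of these domains is the
    open set. *)
Lemma submanifold_locally_closed T (X : smooth_space R T) A :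
  carrier X = setT -> submanifold X A -> locally_closed A.
Proof.
move=> XT [AX sA].
pose N (V : set T) := open V /\ V `&` closure A `<=` A.
exists (\bigcup_(V in N) V), (closure A); split.
- by apply: bigcup_open => V [].
- exact: closed_closure.
apply/seteqP; split => [x Ax|x [[V [oV VA] Vx] cx]]; last exact: VA.
split; last exact: subset_closure.
have [c' sc c'x] := sA x Ax; have [c [i [[[cX _] ie cA] [dE oE iE pE]]]] := sc.
have [V oV VE] := chart_rel_open cX; rewrite XT setTI in VE.
exists V; last by rewrite -VE; move: c'x; rewrite dE => -[].
split => // y [Vy cy].
have dy : dom c y by rewrite VE.
suff : (cod c `&` range i) (coord c y).
  rewrite -cA => -[z [dz Az] zE].
  by rewrite -(coordK cX dy) -zE (coordK cX dz).
split; first exact: (chart_coord cX).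
have := coord_continuous cX; rewrite VE continuous_open_subspace //.
move=> /(_ y (mem_set Vy)) cy'.
apply: contrapT => nr.
have oC : open (~` range i) by apply: closed_openC; exact: embedding_range_closed.
have nY : nbhs y (V `&` coord c @^-1` (~` range i)).
  apply: filterI; first exact: open_nbhs_nbhs.
  by apply: cy'; exact: open_nbhs_nbhs.
have [z [Az [Vz /= nz]]] := cy _ nY; apply: nz.
have dz : dom c z by rewrite VE.
by have [] : (cod c `&` range i) (coord c z) by rewrite -cA; exists z.
Qed.

End Submanifolds.

(** * Products and diffeomorphisms *)

Section Products.
Context {R : realType}.
Implicit Types (S T U : topologicalType).

Lemma within_prodf S T U (V : topologicalType) (A : set S) (B : set T)
    (f : S -> U) (g : T -> V) :
  {within A, continuous f} -> {within B, continuous g} ->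
  {within A `*` B, continuous (fun p => (f p.1, g p.2))}.
Proof.
move=> cf cg; apply: within_pair.
  apply: (@within_comp _ _ _ _ A fst f) cf; first by move=> p [].
  by apply: continuous_subspaceT => p; exact: cvg_fst.
apply: (@within_comp _ _ _ _ B snd g) cg; first by move=> p [].
by apply: continuous_subspaceT => p; exact: cvg_snd.
Qed.

Lemma prod_is_chart T U (A : set T) (B : set U) (c : chart R T) (d : chart R U) :
  is_chart A c -> is_chart B d -> is_chart (A `*` B) (prod_chart c d).
Proof.
move=> cA dB; split; [split|split; [split|split]] => /=.
- exact: hausdorff_prod (chart_hausdorff cA) (chart_hausdorff dB).
- exact: rel_openX (chart_rel_open cA) (chart_rel_open dB).
- exact: open_setX (chart_open cA) (chart_open dB).
- by move=> [x y] [/= cx dy]; split; [exact: (chart_coord cA)|exact: (chart_coord dB)].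
- by move=> [x y] [/= cx dy]; split; [exact: (chart_param cA)|exact: (chart_param dB)].
- by move=> [x y] /set_mem[/= cx dy]; rewrite (coordK cA) // (coordK dB).
- by move=> [x y] /set_mem[/= cx dy]; rewrite (paramK cA) // (paramK dB).
- exact: within_prodf (coord_continuous cA) (coord_continuous dB).
- exact: within_prodf (param_continuous cA) (param_continuous dB).
Qed.

Lemma prod_transition T U (A : set T) (B : set U) (c c' : chart R T)
    (d d' : chart R U) :
  is_chart A c -> is_chart A c' -> is_chart B d -> is_chart B d' ->
  smooth_transition c c' -> smooth_transition d d' ->
  smooth_transition (prod_chart c d) (prod_chart c' d').
Proof.
move=> cA c'A dB d'B sc sd k.
have oc : open (repdom c c' id) by apply: (repdom_open cA c'A) => //; exact: within_id.
have od : open (repdom d d' id) by apply: (repdom_open dB d'B) => //; exact: within_id.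
have -> : cod (prod_chart c d) `&` param (prod_chart c d) @^-1` dom (prod_chart c' d') =
   repdom c c' id `*` repdom d d' id.
  by apply/seteqP; split => -[x y] [] /= [? ?] [? ?].
have op := open_setX oc od.
apply: Ck_pair.
  apply: (@Ck_comp _ _ _ _ _ _ (repdom c c' id) fst (rep c c' id)) => //.
  - by move=> p [].
  - exact: Ck_fst.
apply: (@Ck_comp _ _ _ _ _ _ (repdom d d' id) snd (rep d d' id)) => //.
- by move=> p [].
- exact: Ck_snd.
Qed.

Lemma prod_compatible T U (X : smooth_space R T) (Y : smooth_space R U) c d :
  manifold X -> manifold Y ->
  compatible_chart X c -> compatible_chart Y d ->
  compatible_chart (prod_space X Y) (prod_chart c d).
Proof.
move=> mX mY cX dY; split; first exact: prod_is_chart cX.1 dY.1.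
move=> e [c' [d' [c'X d'Y ->]]].
have c'c := manifold_chart mX c'X; have d'c := manifold_chart mY d'Y.
split; apply: prod_transition; (try exact: cX.1); (try exact: dY.1);
  (try exact: c'c.1); (try exact: d'c.1).
- exact: (cX.2 _ c'X).1.
- exact: (dY.2 _ d'Y).1.
- exact: (cX.2 _ c'X).2.
- exact: (dY.2 _ d'Y).2.
Qed.

Lemma prod_manifold T U (X : smooth_space R T) (Y : smooth_space R U) :
  manifold X -> manifold Y -> manifold (prod_space X Y).
Proof.
move=> mX mY; split.
- apply/hausdorff_onP; apply: hausdorff_on_prod.
    by apply/hausdorff_onP; case: mX.
  by apply/hausdorff_onP; case: mY.
- move=> [x y] [/= Xx Yy]; have [c cX cx] := manifold_cover mX Xx.
  by have [d dY dy] := manifold_cover mY Yy; exists (prod_chart c d) => //; exists c, d.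
- move=> e [c [d [cX dY ->]]]; apply: prod_compatible => //; exact: manifold_chart.
Qed.

Lemma smooth_map_pair S T U (X : smooth_space R S) (Y : smooth_space R T)
    (Z : smooth_space R U) f g :
  manifold X -> manifold Y -> manifold Z ->
  smooth_map X Y f -> smooth_map X Z g ->
  smooth_map X (prod_space Y Z) (fun x => (f x, g x)).
Proof.
move=> mX mY mZ [fXY cf fs] [gXZ cg gs]; split.
- by move=> x Xx; split; [exact: fXY|exact: gXZ].
- exact: within_pair.
move=> c e cX [d [d' [dY d'Z ->]]] k.
apply: Ck_pair.
  by apply: Ck_subset (fs _ _ cX dY k) => x [cx []].
by apply: Ck_subset (gs _ _ cX d'Z k) => x [cx []].
Qed.

Lemma smooth_map_cst T U (X : smooth_space R T) (Y : smooth_space R U) y :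
  carrier Y y -> smooth_map X Y (fun=> y).
Proof.
move=> Yy; split=> //; first by apply: continuous_subspaceT => x; exact: cvg_cst.
by move=> c d _ _ k; exact: Ck_cst.
Qed.

Lemma transport_compatible T U (X : smooth_space R T) (Y : smooth_space R U)
    f g c : manifold X -> manifold Y ->
  smooth_map X Y f -> smooth_map Y X g ->
  {in carrier X, cancel f g} -> {in carrier Y, cancel g f} ->
  compatible_chart X c ->
  compatible_chart Y (Chart (model c) (carrier Y `&` g @^-1` dom c) (cod c)
    (coord c \o g) (f \o param c)).
Proof.
move=> mX mY sf sg fK gK cX.
have [fXY cf _] := sf; have [gYX cg _] := sg.
have cc := cX.1; have cp y : cod c y -> carrier X (param c y).
  by move=> /(chart_param cc)/(chart_sub cc).
split.
  split; [split|split; [split|split]] => /=.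
  - exact: chart_hausdorff cc.
  - apply: (@within_preimage_rel_open _ _ _ (carrier X)) => //.
    exact: chart_rel_open cc.
  - exact: chart_open cc.
  - by move=> y [Yy cy] /=; exact: (chart_coord cc).
  - move=> y cy; split; first by apply: fXY; exact: cp.
    by rewrite /preimage /= fK ?inE; [exact: (chart_param cc)|exact: cp].
  - by move=> y /set_mem[Yy cy] /=; rewrite (coordK cc) // gK // inE.
  - by move=> y /set_mem cy /=; rewrite fK ?inE; [rewrite (paramK cc)|exact: cp].
  - apply: (@within_comp _ _ _ _ (dom c)) (coord_continuous cc); first by move=> y [].
    by apply: continuous_subspaceW cg => y [].
  - apply: (@within_comp _ _ _ _ (carrier X)) (cf) => //.
    exact: param_continuous cc.
move=> d dY; have dc := manifold_chart mY dY; split => k.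
  exact: smooth_map_rep sf cX dc k.
apply: Ck_subset (smooth_map_rep mY mX sg dc cX k) => y [dy /= [_ cy]].
by split.
Qed.

End Products.

(** * Differentials and tangent spaces *)

Section Differential.
Context {R : realType}.
Implicit Types (S T U : topologicalType).

(** The relation [df_x(h) = l], read in the charts [c] and [d]. A relation suits
    the chain rule better than a function: the charts vary with the maps. *)
Definition tder T U (f : T -> U) (c : chart R T) (d : chart R U) (x : T)
    (h : model c) (l : model d) := dirderiv (rep c d f) (coord c x) h l.
Arguments tder {T U} f c d x h l.

Lemma tder_unique T U (B : set U) f (c : chart R T) (d : chart R U) x h l l' :
  is_chart B d -> tder f c d x h l -> tder f c d x h l' -> l = l'.
Proof. by move=> dB; apply: dirderiv_unique; exact: chart_hausdorff dB. Qed.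

Section SmoothMap.
Context T U (X : smooth_space R T) (Y : smooth_space R U) (f : T -> U).
Hypotheses (mX : manifold X) (mY : manifold Y) (sf : smooth_map X Y f).
Context (c : chart R T) (d : chart R U) (x : T).
Hypotheses (cX : compatible_chart X c) (dY : compatible_chart Y d).
Hypotheses (cx : dom c x) (dx : dom d (f x)).

Lemma repdom_smooth_open : open (repdom c d f).
Proof. by case: sf => fXY cf _; exact: repdom_open cX.1 dY.1 fXY cf. Qed.

Lemma repdom_coord : repdom c d f (coord c x).
Proof.
split; first exact: (chart_coord cX.1).
by rewrite /preimage /= (coordK cX.1).
Qed.

Lemma rep_C1 : exists df, C1 (repdom c d f) (rep c d f) df.
Proof.
have [df C1f _] := Ck_C1 repdom_smooth_open (smooth_map_rep mX mY sf cX dY 1%N).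
by exists df.
Qed.

Lemma tder_exists : exists D : model c -> model d,
  [/\ linear D, continuous D & forall h, tder f c d x h (D h)].
Proof.
have [df C1f] := rep_C1; exists (fun h => df (coord c x, h)); split.
- exact: C1_linear (chart_hausdorff dY.1) C1f repdom_coord.
- exact: C1_continuous C1f repdom_coord.
- by move=> h; case: C1f => _ fdf _; apply: fdf; exact: repdom_coord.
Qed.

End SmoothMap.

Lemma tder_comp S T U (X : smooth_space R S) (Y : smooth_space R T)
    (Z : smooth_space R U) f g c d e x h l l' :
  manifold Y -> manifold Z -> smooth_map X Y f -> smooth_map Y Z g ->
  compatible_chart X c -> compatible_chart Y d -> compatible_chart Z e ->
  dom c x -> dom d (f x) -> dom e (g (f x)) ->
  tder f c d x h l -> tder g d e (f x) l l' -> tder (g \o f) c e x h l'.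
Proof.
move=> mY mZ sf sg cX dY eZ cx dx ex fl gl.
have [dg C1g] := rep_C1 mY mZ sg dY eZ.
have fxE : rep c d f (coord c x) = coord d (f x) by rewrite /rep /= (coordK cX.1).
have Dfx : repdom d e g (rep c d f (coord c x)).
  by rewrite fxE; exact: (repdom_coord dY).
have gfl := dirderiv_comp fl C1g Dfx; rewrite fxE in gfl.
have l'E : dg (coord d (f x), l) = l'.
  apply: (tder_unique eZ.1 _ gl); case: C1g => _ gdg _.
  by apply: gdg; rewrite -fxE.
rewrite l'E in gfl.
apply: dirderiv_eqon (repdom_smooth_open sf cX dY) _ _ gfl.
  by move=> y [_ /= dy]; rewrite /rep /= (coordK dY.1).
exact: (repdom_coord cX).
Qed.

Lemma tder_id T (X : smooth_space R T) c x h :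
  compatible_chart X c -> dom c x -> tder id c c x h h.
Proof.
move=> cX cx.
have := dirderiv_id (coord c x) h.
apply: (@dirderiv_eqon _ _ _ (cod c)).
- exact: chart_open cX.1.
- by move=> y cy; rewrite /rep /= (paramK cX.1).
- exact: (chart_coord cX.1).
Qed.

Arguments tder_id {T X c x} h _ _.

Lemma tder_cst T U (X : smooth_space R T) (f : T -> U) c (d : chart R U) x h :
  compatible_chart X c -> dom c x ->
  (forall y, carrier X y -> f y = f x) ->
  tder f c d x h 0.
Proof.
move=> cX cx fcst.
have : (fun t : R => (0 : model d)) @ 0^' --> (0 : model d) by exact: cvg_cst.
apply: cvg_trans; apply: near_eq_cvg.
have := near_ray h (chart_open cX.1) (chart_coord cX.1 cx).
apply: filterS => t ct; rewrite /rep /= (coordK cX.1) // fcst ?subrr ?scaler0 //.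
exact: (chart_sub cX.1 (chart_param cX.1 ct)).
Qed.

(** In these charts the inclusion is the restriction of the linear map [i]. *)
Lemma tder_sub_chart T (X : smooth_space R T) (A : set T)
    (c c' : chart R T) (i : model c' -> model c) x h :
  compatible_chart X c -> compatible_chart (sub_space X A) c' ->
  linear i -> continuous i -> cod c' = i @^-1` cod c ->
  {in cod c', param c' =1 param c \o i} -> dom c' x ->
  tder id c' c x h (i h).
Proof.
move=> cX c'A li ci oE pE c'x.
have := dirderiv_linear li ci (dirderiv_id (coord c' x) h).
apply: (@dirderiv_eqon _ _ _ (cod c')).
- exact: chart_open c'A.1.
- move=> y cy; rewrite /rep /= pE ?inE //= (paramK cX.1) //.
  by move: cy; rewrite oE.
- exact: (chart_coord c'A.1).
Qed.

Lemma tder_transition_cancel T (X : smooth_space R T) c d x D D' :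
  manifold X -> compatible_chart X c -> compatible_chart X d ->
  dom c x -> dom d x ->
  (forall h, tder id c d x h (D h)) -> (forall l, tder id d c x l (D' l)) ->
  cancel D D'.
Proof.
move=> mX cX dX cx dx DD DD' h; have sid := smooth_map_id mX.
apply: (tder_unique cX.1 _ (tder_id h cX cx)).
exact: (tder_comp mX mX sid sid cX dX cX cx dx cx (DD h) (DD' (D h))).
Qed.

End Differential.

Arguments tder {R T U} f c d x h l.
Arguments tder_id {R T X c x} h _ _.

Section TangentSpaces.
Context {R : realType}.
Implicit Types (S T U : topologicalType).

(** Tangent vectors are classes of pairs of a chart and a vector; two pairs
    represent the same one when the transition map relates them. *)
Lemma tangent_vectorE T (X : smooth_space R T) x c d (v : model c) (w : model d) :
  manifold X -> atlas X c -> atlas X d -> dom c x -> dom d x ->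
  tangent_vector X x v = tangent_vector X x w <-> tder id c d x v w.
Proof.
move=> mX cX dX cx dx; have sid := smooth_map_id mX.
have cc := manifold_chart mX cX; have dc := manifold_chart mX dX.
split=> [vw|vw].
  have : tangent_vector X x w (Tagged (@model R T) w).
    by split => //; exact: tder_id dc dx.
  by rewrite -vw => -[].
apply/funext => -[e u]; apply/propext; split => -[/= eX ex eu]; split => //=.
  have ec := manifold_chart mX eX.
  have [D [_ _ DD]] := tder_exists mX mX sid dc ec dx ex.
  have := tder_comp mX mX sid sid cc dc ec cx dx ex vw (DD w).
  by move=> /(tder_unique ec.1 eu) ->; exact: DD.
have ec := manifold_chart mX eX.
exact: (tder_comp mX mX sid sid cc dc ec cx dx ex vw eu).
Qed.

(** The charts [c] and [d] identify the tangent spaces with their model spaces,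
    and a change of charts composes [L] with continuous linear maps. *)
Lemma tangent_map_exists T U (X : smooth_space R T) (Y : smooth_space R U)
    x y c d (L : model c -> model d) : manifold X -> manifold Y ->
  atlas X c -> dom c x -> atlas Y d -> dom d y ->
  linear L -> continuous L -> injective L ->
  exists A, injective_continuous_linear X x Y y A.
Proof.
move=> mX mY cX cx dY dy lL cL iL.
have sidX := smooth_map_id mX; have sidY := smooth_map_id mY.
have cc := manifold_chart mX cX; have dc := manifold_chart mY dY.
(* the coordinates of a tangent vector in [c]; the default 0 is taken outside of
   the tangent space only *)
pose crd (xi : {d : chart R T & model d} -> Prop) : model c :=
  xget 0 [set v | xi = tangent_vector X x v].
have crdE v : crd (tangent_vector X x v) = v.
  rewrite /crd; case: xgetP => [w -> /= |/(_ v) nv]; last by case: nv.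
  move=> /tangent_vectorE-/(_ mX cX cX cx cx).
  by move=> vw; exact: (tder_unique cc.1 vw (tder_id v cc cx)).
have exT e : atlas X e -> dom e x -> exists D : model e -> model c,
    [/\ linear D, continuous D & forall v, tangent_vector X x v = tangent_vector X x (D v)].
  move=> eX ex; have [D [lD cD DD]] := tder_exists mX mX sidX (manifold_chart mX eX) cc ex cx.
  by exists D; split => // v; apply/(tangent_vectorE v (D v) mX).
exists (fun xi => tangent_vector Y y (L (crd xi))); split.
- by move=> xi _; exists d, (L (crd xi)).
- move=> xi eta [e [v [eX ex ->]]] [e' [v' [e'X e'x ->]]].
  have [D [_ _ ->]] := exT e eX ex; have [D' [_ _ ->]] := exT e' e'X e'x.
  rewrite !crdE => /(tangent_vectorE _ _ mY dY dY dy dy) LD.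
  congr tangent_vector; apply: iL; apply: esym.
  exact: (tder_unique dc.1 LD (tder_id _ dc dy)).
move=> e e' eX ex e'Y e'y; have [D [lD cD DE]] := exT e eX ex.
have e'c := manifold_chart mY e'Y.
have [D' [lD' cD' DD']] := tder_exists mY mY sidY dc e'c dy e'y.
exists (D' \o L \o D); split.
- by move=> a u v; rewrite /= lD lL lD'.
- move=> v; apply: continuous_comp; first exact: cD.
  by apply: continuous_comp; [exact: cL|exact: cD'].
- move=> v; rewrite DE crdE; exact/(tangent_vectorE _ _ mY).
Qed.

(** [D (i w)] is a limit of difference quotients along a curve in [A], and these
    lie in the closed subspace [Z]. *)
Lemma sub_tangent_in T (X : smooth_space R T) (A : set T) (c c' : chart R T)
    (i : model c' -> model c) (P : chart R T) (D : model c -> model P)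
    (Z : set (model P)) (x : T) :
  manifold X -> compatible_chart X c -> compatible_chart X P ->
  coord c @` (dom c `&` A) = cod c `&` range i -> linear i ->
  coord c x = i (coord c' x) ->
  dom c x -> dom P x -> (forall h, tder id c P x h (D h)) ->
  closed Z -> (forall a u v, Z u -> Z v -> Z (a *: (u - v))) -> Z (coord P x) ->
  (forall a, A a -> dom P a -> Z (coord P a)) ->
  forall w, Z (D (i w)).
Proof.
move=> mX cX PX cA il xE cx Px DD cZ sZ Zx AZ w.
apply: (closed_cvg _ cZ _ _ (DD (i w))).
have oD : open (repdom c P id) by exact: (repdom_smooth_open (smooth_map_id mX)).
have := near_ray (i w) oD (repdom_coord cX (f := id) cx Px).
apply: filterS => t [ct /= Pt].
rewrite /rep /= (coordK cX.1) //; apply: (sZ) => //; apply: AZ => //.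
have : (cod c `&` range i) (coord c x + t *: i w).
  split => //; exists (coord c' x + t *: w) => //.
  by rewrite linear_funD // linear_funZ // xE.
by rewrite -cA => -[a [ca Aa] aE]; rewrite -aE (coordK cX.1 ca).
Qed.

(** In the chart [d] the ray becomes a curve in the closed range of [i], so its
    velocity lies there too. *)
Lemma sub_tangent_contains T (X : smooth_space R T) (A : set T) (d d' : chart R T)
    (i : model d' -> model d) (P : chart R T) (D : model P -> model d)
    (x : T) (z : model P) :
  manifold X -> compatible_chart X d -> compatible_chart X P ->
  coord d @` (dom d `&` A) = cod d `&` range i -> closed_linear_embedding i ->
  A x -> dom d x -> dom P x -> (forall h, tder id P d x h (D h)) ->
  (\forall t \near (0 : R)^', A (param P (coord P x + t *: z))) ->
  range i (D z).
Proof.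
move=> mX dX PX dA ie Ax dx Px DD Az; have [il _ _ _] := ie.
have inA a : A a -> dom d a -> range i (coord d a).
  by move=> Aa da; have [] : (cod d `&` range i) (coord d a) by rewrite -dA; exists a.
apply: (closed_cvg _ (embedding_range_closed ie) _ _ (DD z)).
have oD : open (repdom P d id) by exact: (repdom_smooth_open (smooth_map_id mX)).
have := near_ray z oD (repdom_coord PX (f := id) Px dx).
apply: filterS2 Az => t At [Pt /= dt].
have [u _ uE] := inA _ At dt; have [v _ vE] := inA _ Ax dx.
exists (t^-1 *: (u - v)) => //.
by rewrite linear_funZ // linear_funB // /rep /= (coordK PX.1) // uE vE.
Qed.

End TangentSpaces.

(** * Compactness arguments *)

Section DescendingChains.
Context {R : realType}.

Lemma compact_seq_cluster (T : topologicalType) (K : set T) (x : nat -> T) :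
  compact K -> (forall n, K (x n)) ->
  exists2 p, K p & forall A, nbhs p A -> forall N, exists2 n, (N <= n)%N & A (x n).
Proof.
move=> cK Kx.
have [|p [Kp px]] := cK (x @ \oo) _; first by exists 0%N => // n _ /=; exact: Kx.
exists p => // A pA N.
have [|y [[n Nn <-] Ay]] := px [set x n | n in [set n | (N <= n)%N]] A _ pA.
  by exists N => // n /= Nn; exists n.
by exists n.
Qed.

Lemma compact_bounded (E : tvsType R) (K N : set E) :
  compact K -> nbhs (0 : E) N ->
  exists2 e : R, 0 < e & forall t, `|t| < e -> forall x, K x -> N (t *: x).
Proof.
move=> /compact_near_coveringP cK N0.
have : \forall t \near (0 : R), K `<=` [set x | N (t *: x)].
  apply: (cK R (nbhs (0 : R)) (fun t x => N (t *: x))) => x Kx.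
  have := @scale_continuous R E (0, x) N; rewrite /= scale0r => /(_ N0) [[A B] /= [A0 Bx] AB].
  by exists (B, A) => // -[y t] [/= By At]; exact: (AB (t, y)).
move=> /nbhs_ballP[e /= e0 eN]; exists e => // t te x Kx; apply: eN => //.
by rewrite /ball /= sub0r normrN.
Qed.

Definition is_subspace (E : lmodType R) (F : set E) :=
  F 0 /\ forall a u v, F u -> F v -> F (a *: u + v).

(** If the conclusion failed then [F' `&` V] would lie in [F + 2^-k V] for all
    [k], hence in the closed set [F] because [V] is bounded; but every element
    of [F'] has a nonzero multiple in [V]. *)
Lemma riesz (E : tvsType R) (K V F F' : set E) :
  compact K -> V `<=` K -> nbhs 0 V -> is_subspace F -> is_subspace F' ->
  closed F -> F `<=` F' -> (exists2 e, F' e & ~ F e) ->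
  exists2 x, F' x /\ V x & forall f v, F f -> V v -> x <> f + 2^-1 *: v.
Proof.
move=> cK VK V0 [F0 FL] [F'0 F'L] cF FF' [e F'e nFe].
apply: contrapT => nx.
have step x : F' x -> V x -> exists f v, [/\ F f, F' v, V v & x = f + 2^-1 *: v].
  move=> F'x Vx; apply: contrapT => nfv; apply: nx; exists x => // f v Ff Vv xE.
  apply: nfv; exists f, v; split => //.
  have -> : v = 2 *: x + (-2) *: f.
    rewrite xE scalerDr scalerA divff // scale1r scaleNr.
    by rewrite addrAC subrr add0r.
  apply: (F'L) => //; rewrite -[_ *: f]addr0; apply: (F'L) => //.
  exact: FF'.
have iterstep k x : F' x -> V x ->
    exists f v, [/\ F f, F' v, V v & x = f + (2^-1) ^+ k *: v].
  move=> F'x Vx; elim: k => [|k [f [v [Ff F'v Vv ->]]]].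
    by exists 0, x; rewrite expr0 scale1r add0r.
  have [g [w [Fg F'w Vw ->]]] := step v F'v Vv.
  exists ((2^-1) ^+ k *: g + f), w; split => //; first exact: FL.
  by rewrite exprSr scalerDr scalerA addrCA addrA.
have F'V x : F' x -> V x -> F x.
  move=> F'x Vx; rewrite [F](closure_id _).1 // => N xN.
  have N0 : nbhs 0 [set u | N (x - u)].
    have := @sub_continuous E (x, 0) N; rewrite /= subr0 => /(_ xN) [[A B] /= [Ax B0] AB].
    apply: filterS B0 => u Bu; apply: (AB (x, u)); split => //=.
    exact: nbhs_singleton.
  have [r r0 rN] := compact_bounded cK N0.
  have [k kr] : exists k, `|(2^-1) ^+ k| < r :> R.
    have := @cvg_geometric R 1 2^-1.
    rewrite ger0_norm // invf_lt1 // ltr1n => /(_ isT).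
    move=> /cvgrPdist_lt/(_ r r0)[k _ /(_ k (leqnn k))].
    by rewrite /geometric /= mul1r sub0r normrN => ?; exists k.
  have [f [v [Ff F'v Vv xE]]] := iterstep k x F'x Vx.
  exists f; split => //; have := rN _ kr v (VK _ Vv).
  by rewrite /= {1}xE addrK.
have [t t0 Vte] : exists2 t : R, t != 0 & V (t *: e).
  have := @scale_continuous R E (0, e) V; rewrite /= scale0r => /(_ V0) [[A B] /= [A0 Be] AB].
  have /nbhs_ballP[r /= r0 rA] := A0.
  exists (r / 2); first by rewrite mulf_neq0 ?invr_neq0 ?gt_eqF.
  apply: (AB (r / 2, e)); split => /=; last exact: nbhs_singleton.
  apply: rA; rewrite /ball /= sub0r normrN ger0_norm ?divr_ge0 ?ltW //.
  by rewrite ltr_pdivrMr // ltr_pMr // ltr1n.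
apply: nFe; have -> : e = t^-1 *: (t *: e) + 0.
  by rewrite addr0 scalerA mulVf // scale1r.
apply: (FL) => //; apply: (F'V) => //.
by rewrite -[_ *: e]addr0; exact: F'L.
Qed.

(** The replacement for a dimension count. Otherwise the ranges of the iterates
    of [j] decrease strictly; the vectors which [riesz] picks between successive
    ranges stay in [K] and keep a distance from each other, so they cannot
    cluster. *)
Lemma locally_compact_embedding_onto (E : tvsType R) (j : E -> E) (K : set E) :
  closed_linear_embedding j -> compact K -> nbhs 0 K -> forall x, range j x.
Proof.
move=> [lj ij cj clj] cK K0 x; apply: contrapT => nx.
pose F n := range (iter n j).
have lin n : linear (iter n j) by elim: n => [//|n IH] a u v /=; rewrite IH lj.
have inj n : injective (iter n j) by elim: n => [//|n IH] u v /= /ij/IH.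
have Fs n : is_subspace (F n).
  split; first by exists 0 => //; elim: n => [|n /= ->] //; exact: (linear_fun0 lj).
  by move=> a _ _ [u _ <-] [v _ <-]; exists (a *: u + v); rewrite ?lin.
have Fc n : closed (F n).
  elim: n => [|n IH]; first by rewrite /F image_id; exact: closedT.
  have -> : F n.+1 = j @` F n.
    apply/seteqP; split => [_ [u _ <-]|_ [_ [u _ <-] <-]].
      by exists (iter n j u) => //; exists u.
    by exists u.
  exact: clj.
have FS n : F n.+1 `<=` F n by move=> _ [u _ <-]; exists (j u) => //; rewrite -iterSr.
have Fle n m : (n <= m)%N -> F m `<=` F n.
  by move=> /subnK <-; elim: (m - n)%N => [|k IH] // u /FS/IH.
have proper n : exists2 e, F n e & ~ F n.+1 e.
  exists (iter n j x); first by exists x.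
  by move=> [u _]; rewrite iterSr => /inj jux; apply: nx; exists u.
have [xs xsP] : {xs : nat -> E & forall n, (F n (xs n) /\ K (xs n)) /\
    forall f v, F n.+1 f -> K v -> xs n <> f + 2^-1 *: v}.
  apply: (@choice _ _ (fun n y => (F n y /\ K y) /\
    forall f v, F n.+1 f -> K v -> y <> f + 2^-1 *: v)) => n.
  have [y yP1 yP2] := riesz cK (fun _ h => h) K0 (Fs n.+1) (Fs n) (Fc _) (FS n)
    (proper n).
  by exists y.
have [p Kp pcl] := compact_seq_cluster cK (fun n => (xsP n).1.2).
(* points of the sequence near a cluster point [p] differ by an element of
   [K / 2], which [riesz] forbids *)
have N0 : nbhs (p - p) [set v : E | K (2 *: v)].
  have := @scale_continuous R E (2, 0) K; rewrite /= scaler0 subrr => /(_ K0) [[A B] /= [A0 B0] AB].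
  by apply: filterS B0 => v Bv; apply: (AB (2, v)); split => //=; exact: nbhs_singleton.
have [[A B] /= [Ap Bp] AB] := @sub_continuous E (p, p) _ N0.
have [n _ [An Bn]] := pcl _ (filterI Ap Bp) 0%N.
have [m nm [Am Bm]] := pcl _ (filterI Ap Bp) n.+1.
apply: ((xsP n).2 (xs m) (2 *: (xs n - xs m))).
- by apply: (Fle _ _ nm); exact: (xsP m).1.1.
- exact: (AB (xs n, xs m)).
- by rewrite scalerA mulVf // scale1r addrC subrK.
Qed.

(** Otherwise points picked between successive sets cluster at some [p]; a
    connected neighbourhood of [p] contains two of them, and is split by a
    clopen set in between. *)
Lemma clopen_chain_stops (T : topologicalType) (H : set T) (L : nat -> set T) :
  compact H ->
  (forall p, H p -> exists C, [/\ connected C, C `<=` H, C p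
     & exists2 W, open W /\ W p & H `&` W `<=` C]) ->
  (forall n, L n `<=` H) -> (forall n, L n.+1 `<=` L n) ->
  (forall n, rel_open H (L n)) -> (forall n, rel_closed H (L n)) ->
  exists n, L n.+1 = L n.
Proof.
move=> cH lcH LH LS oL cL; apply: contrapT => nL.
have Lle n m : (n <= m)%N -> L m `<=` L n.
  by move=> /subnK <-; elim: (m - n)%N => [|k IH] // u /LS/IH.
have [x xP] : {x : nat -> T & forall n, L n (x n) /\ ~ L n.+1 (x n)}.
  apply: (@choice _ _ (fun n y => L n y /\ ~ L n.+1 y)) => n.
  apply: contrapT => nx; apply: nL; exists n; apply/seteqP; split; first exact: LS.
  by move=> y Ly; apply: contrapT => nLy; apply: nx; exists y.
have [p Hp pcl] := compact_seq_cluster cH (fun n => LH n _ (xP n).1).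
have [C [cC CH Cp [W [oW Wp] WC]]] := lcH p Hp.
have nW : nbhs p W by exact: open_nbhs_nbhs.
have [n _ Wn] := pcl _ nW 0%N; have [m nm Wm] := pcl _ nW n.+1.
have Cn : C (x n) by apply: WC; split => //; exact: LH (xP n).1.
have Cm : C (x m) by apply: WC; split => //; exact: LH (xP m).1.
have LC : C `&` L n.+1 = C.
  apply: cC.
  - by exists (x m); split => //; apply: (Lle _ _ nm); exact: (xP m).1.
  - by have [V oV ->] := oL n.+1; exists V => //; rewrite setIA (setIidl CH).
  - by have [V cV ->] := cL n.+1; exists V => //; rewrite setIA (setIidl CH).
by apply: (xP n).2; have : C (x n) by []; rewrite -LC => -[].
Qed.

Lemma convex_connected (E : tvsType R) (D : set E) : convex D -> connected D.
Proof.
move=> cD; have [[x Dx]|/set0P/negP/negPn/eqP ->] := pselect (D !=set0); last first.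
  exact: connected0.
have -> : D = \bigcup_(y in D) [set s *: y + (1 - s) *: x | s in `[(0 : R), 1]].
  apply/seteqP; split => [y Dy|z [y Dy [s /= s01 <-]]].
    exists y => //; exists 1; first by rewrite /= in_itv /= lexx ler01.
    by rewrite scale1r subrr scale0r addr0.
  by apply: cD => //; move: s01; rewrite in_itv.
apply: bigcup_connected.
  exists x => y Dy; exists 0; first by rewrite /= in_itv /= lexx ler01.
  by rewrite scale0r subr0 scale1r add0r.
move=> y Dy; apply: connected_continuous_connected; first exact: segment_connected.
apply: continuous_subspaceT => s; apply: tvs_cvgD.
  by apply: tvs_cvgZ; [exact: cvg_id|exact: cvg_cst].
apply: tvs_cvgZ; last exact: cvg_cst.
by apply: (@tvs_cvgB R R^o); [exact: cvg_cst|exact: cvg_id].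
Qed.

Lemma manifold_locally_connected (T : topologicalType) (X : smooth_space R T) p :
  manifold X -> carrier X p ->
  exists C, [/\ connected C, C `<=` carrier X, C p
     & exists2 W, open W /\ W p & carrier X `&` W `<=` C].
Proof.
move=> mX Xp; have [c cX cp] := manifold_cover mX Xp.
have [cc _] := manifold_chart mX cX.
have [D [oD Dp Dc cD]] := nbhs_convex (open_nbhs_nbhs (conj (chart_open cc) (chart_coord cc cp))).
exists (param c @` D); split.
- apply: connected_continuous_connected; first exact: convex_connected.
  exact: continuous_subspaceW (param_continuous cc).
- by move=> _ [y /Dc cy <-]; exact: (chart_sub cc (chart_param cc cy)).
- by exists (coord c p) => //; rewrite (coordK cc).
have oDc : rel_open (dom c) (dom c `&` coord c @^-1` D).
  apply: (@within_preimage_rel_open _ _ _ setT) => //; first exact: coord_continuous cc.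
  by exists D => //; rewrite setTI.
have [W oW WE] := rel_open_trans (chart_rel_open cc) oDc.
exists W.
  split => //; have : (dom c `&` coord c @^-1` D) p by [].
  by rewrite WE => -[].
rewrite -WE => x [cx Dx]; exists (coord c x) => //; exact: (coordK cc).
Qed.

End DescendingChains.

Section LocallyCompact.
Context {R : realType}.

(** A compact Hausdorff space is regular, so the domain of the chart contains a
    compact neighbourhood of [x]; its image is translated to the origin. *)
Lemma manifold_compact_chart (T : topologicalType) (X : smooth_space R T) c x :
  manifold X -> compact (carrier X) -> atlas X c -> dom c x ->
  exists2 K : set (model c), compact K & nbhs 0 K.
Proof.
move=> mX cX aX cx; have [cc _] := manifold_chart mX aX.
set A := carrier X in cX cc *.
have hA : hausdorff_space (subspace A) by case: mX.
have Ax : A x by exact: chart_sub cx.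
have cA : compact (A : set (subspace A)).
  by have := (@compact_subspaceIP T A A).2; rewrite setIid; apply.
have nA : nbhs (x : subspace A) A.
  by rewrite nbhs_subspace_within //; exact: withinT.
have nsub (W : set T) : open W -> W x -> nbhs (x : subspace A) (A `&` W).
  move=> oW Wx; rewrite nbhs_subspace_within //.
  have n0 : nbhs (x : T) W by apply: open_nbhs_nbhs.
  by apply: (@filterS _ _ _ _ _ _ n0) => z Wz Az; split.
have ndom : nbhs (x : subspace A) (dom c).
  have [W oW WE] := chart_rel_open cc; rewrite WE; apply: nsub => //.
  by move: cx; rewrite WE => -[].
have [C nC Cdom] := compact_regular hA cA nA ndom.
have cC : compact (closure C : set (subspace A)).
  apply: (subclosed_compact _ cA); first exact: closed_closure.
  by move=> y /Cdom; exact: chart_sub.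
pose C' : set T := closure (C : set (subspace A)).
have C'dom : C' `<=` dom c := Cdom.
have cCT : compact C'.
  have CA : C' `&` A = C' by apply: setIidl => y /Cdom; exact: chart_sub.
  by have := (@compact_subspaceIP T A C').1; rewrite CA; apply.
have cK : compact (coord c @` C').
  apply: continuous_compact => //.
  exact: continuous_subspaceW (coord_continuous cc).
exists ((fun y => y - coord c x) @` (coord c @` C')).
  apply: continuous_compact => //; apply: continuous_subspaceT => y.
  by apply: tvs_cvgB; [exact: cvg_id|exact: cvg_cst].
have [W [oW Wx] WC] : exists2 W : set T, open W /\ W x & A `&` W `<=` C.
  move: nC; rewrite nbhs_subspace_within // /within /= nbhsE => -[W [oW Wx] WC].
  by exists W => // y [Ay Wy]; exact: WC.
have oP : open (cod c `&` param c @^-1` (A `&` W)).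
  apply: (@within_preimage_open _ _ _ A) (param_continuous cc) _ _.
  - exact: chart_open cc.
  - by move=> y /(chart_param cc)/(chart_sub cc).
  - by exists W.
have nP : nbhs (coord c x) (cod c `&` param c @^-1` (A `&` W)).
  apply: open_nbhs_nbhs; split => //; split; first exact: (chart_coord cc).
  by rewrite /preimage /= (coordK cc).
have := @add_continuous (model c) (0, coord c x) _; rewrite /= add0r => /(_ _ nP).
move=> [[B B'] /= [B0 B'x] BB']; apply: filterS B0 => y By.
have [cy Wy] := BB' (y, coord c x) (conj By (nbhs_singleton B'x)).
exists (y + coord c x); last by rewrite addrK.
exists (param c (y + coord c x)); last exact: (paramK cc).
by apply: subset_closure; exact: WC.
Qed.

End LocallyCompact.

Lemma image_injective (T U : Type) (f : T -> U) (A B : set T) :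
  injective f -> f @` A = f @` B -> A = B.
Proof.
move=> fi AB; apply/seteqP; split => x Ax.
  have : (f @` A) (f x) by exists x.
  by rewrite AB => -[y By /fi <-].
have : (f @` B) (f x) by exists x.
by rewrite -AB => -[y By /fi <-].
Qed.

(** * Conjugates of a compact Lie subgroup *)

Section LieSubgroups.
Context {R : realType} {Gt : preTopologicalGroupType}.
Implicit Types (G : smooth_space R Gt) (H L : set Gt).
Local Open Scope group_scope.

Lemma coset_projP L g h : is_subgroup L ->
  coset_proj L g = coset_proj L h <-> L (g^-1 * h).
Proof.
move=> [L1 LM LV].
have -> : coset_proj L g = coset_proj L h <-> coset_rel L g h.
  by split=> [/(eqmodP (coset_equiv L))|gh]; [|apply/(eqmodP (coset_equiv L))].
split=> [/asboolP gh|Lgh].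
  have : left_coset L h h by exists 1 => //; rewrite mulg1.
  by rewrite -gh => -[k Lk <-]; rewrite mulKg.
apply/asboolP/seteqP; split => _ [k Lk <-].
  exists (h^-1 * g * k); first by apply: LM => //; have := LV _ Lgh; rewrite invgM invgK.
  by rewrite !mulgA mulgV mul1g.
exists (g^-1 * h * k); first exact: LM.
by rewrite !mulgA mulgV mul1g.
Qed.

Lemma coset_proj_continuous L : continuous (coset_proj L).
Proof. exact: pi_continuous. Qed.

Definition conjL (a : Gt) (h : Gt) := a * h * a^-1.

Lemma conjLM a b h : conjL a (conjL b h) = conjL (a * b) h.
Proof. by rewrite /conjL invgM !mulgA. Qed.

Lemma conjL1 h : conjL 1 h = h.
Proof. by rewrite /conjL invg1 mul1g mulg1. Qed.

Lemma conjLK a : cancel (conjL a) (conjL a^-1).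
Proof. by move=> h; rewrite conjLM mulVg conjL1. Qed.

Lemma conjLVK a : cancel (conjL a^-1) (conjL a).
Proof. by move=> h; rewrite conjLM mulgV conjL1. Qed.

Section WholeGroup.
Context (G : smooth_space R Gt).
Hypotheses (GT : carrier G = setT) (Glie : lie_group G).

Let mG : manifold G. Proof. by case: Glie. Qed.

Lemma smooth_mulr a : smooth_map G G (fun g => g * a).
Proof.
have [_ _ sM _] := Glie; have mGG := prod_manifold mG mG.
have sp : smooth_map G (prod_space G G) (fun g => (g, a)).
  apply: (smooth_map_pair mG mG mG); first exact: smooth_map_id.
  by apply: smooth_map_cst; rewrite GT.
exact: (smooth_map_comp mG mGG mG sp sM).
Qed.

Lemma smooth_mull a : smooth_map G G (fun g => a * g).
Proof.
have [_ _ sM _] := Glie; have mGG := prod_manifold mG mG.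
have sp : smooth_map G (prod_space G G) (fun g => (a, g)).
  apply: (smooth_map_pair mG mG mG); last exact: smooth_map_id.
  by apply: smooth_map_cst; rewrite GT.
exact: (smooth_map_comp mG mGG mG sp sM).
Qed.

Lemma smooth_conj a : smooth_map G G (conjL a).
Proof. exact: (smooth_map_comp mG mG mG (smooth_mull a) (smooth_mulr a^-1)). Qed.

Lemma conj_continuous a : continuous (conjL a).
Proof.
have [_ + _] := smooth_conj a; rewrite GT; exact: (continuous_subspace_setT _).2.
Qed.

(** The differential [j] of the conjugation [phi] at the identity embeds the
    model space of [H] as a closed subspace of itself, hence is onto because [H]
    is locally compact. The projection to [H / L] is constant on
    [phi @` H], so its differential vanishes on the range of [j], that is,
    everywhere. As the projection has the smooth section [chi], the model space
    of [H / L] is zero and the coset [L] is an open point. *)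
Lemma conjugate_subgroup_open H L a (Q : smooth_space R (coset_space L))
    (U : set (coset_space L)) (chi : coset_space L -> Gt) :
  lie_subgroup G H -> compact H -> is_subgroup L -> L `<=` H ->
  (forall h, H h -> L (conjL a h)) ->
  manifold Q -> carrier Q = coset_proj L @` H ->
  smooth_map (sub_space G H) Q (coset_proj L) ->
  rel_open (carrier Q) U -> U (coset_proj L 1) ->
  smooth_map (sub_space Q U) (sub_space G H) chi ->
  (forall u, U u -> coset_proj L (chi u) = u) ->
  rel_open H L.
Proof.
move=> [Hg Hs] cH Lg LH aHL mQ QE spi oU U1 schi chiK.
have mH := sub_space_manifold mG Hs; set XH := sub_space G H in mH spi schi.
have [H1 HM HV] := Hg; have [L1 LM LV] := Lg.
pose phi := conjL a.
have sphi : smooth_map XH XH phi.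
  apply: (smooth_map_into mH mG Hs); first by move=> h Hh; exact/LH/aHL.
  exact: smooth_map_restrict (smooth_conj a).
have [c' c'X c'1] := manifold_cover mH (H1 : carrier XH 1).
have phi1 : phi 1 = 1 by rewrite /phi /conjL mulg1 mulgV.
have c'phi1 : dom c' (phi 1) by rewrite phi1.
have c'c := manifold_chart mH c'X.
have [c [i [[cG ie cH'] [dE oE iE pE]]]] := c'X.
have [il ii ic icl] := ie.
have c1 : dom c 1 by move: c'1; rewrite dE => -[].
have [j [lj cj jD]] := tder_exists mH mH sphi c'c c'c c'1 c'phi1.
have cphi1 : dom c (phi 1) by rewrite phi1.
have [D [lD cD DD]] := tder_exists mG mG (smooth_conj a) cG cG c1 cphi1.
have cphiV1 : dom c (conjL a^-1 1) by rewrite /conjL mulg1 mulgV.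
have [D' [lD' cD' DD']] := tder_exists mG mG (smooth_conj a^-1) cG cG c1 cphiV1.
have DK : cancel D D'.
  move=> h; apply: (tder_unique cG.1 _ (tder_id h cG c1)).
  have -> : id = conjL a^-1 \o conjL a by apply/funext => g /=; rewrite conjLK.
  apply: (tder_comp mG mG (smooth_conj a) (smooth_conj _) cG cG cG c1 cphi1 _ (DD h)).
    by rewrite -/phi phi1.
  by rewrite -/phi phi1.
have DVK : cancel D' D.
  move=> h; apply: (tder_unique cG.1 _ (tder_id h cG c1)).
  have -> : id = conjL a \o conjL a^-1 by apply/funext => g /=; rewrite conjLVK.
  have phiV1 : conjL a^-1 1 = 1 by rewrite /conjL mulg1 mulgV.
  apply: (tder_comp mG mG (smooth_conj _) (smooth_conj _) cG cG cG c1 cphiV1 _ (DD' h)).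
    by rewrite phiV1.
  by rewrite phiV1.
have incl h : tder id c' c 1 h (i h).
  exact: tder_sub_chart cG c'c il ic oE pE c'1.
have sincl := smooth_incl mG Hs.
(* [j] is the restriction of the differential [D] of the conjugation on [G] *)
have ijE h : i (j h) = D (i h).
  have t1 : tder phi c' c 1 h (i (j h)).
    apply: (tder_comp mH mG sphi sincl c'c c'c cG c'1 c'phi1 _ (jD h)).
      by rewrite phi1.
    by rewrite phi1.
  apply: (tder_unique cG.1 t1).
  exact: (tder_comp mG mG sincl (smooth_conj a) c'c cG cG c'1 c1 cphi1 (incl h) (DD _)).
have je : closed_linear_embedding j.
  split=> //.
    by move=> u v uv; apply: ii; apply: (can_inj DK); rewrite -!ijE uv.
  move=> C cC.
  have -> : j @` C = i @^-1` (D' @^-1` (i @` C)).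
    apply/seteqP; split => [_ [u Cu <-]|u [v Cv vE]].
      by exists u => //=; rewrite ijE DK.
    by exists v => //; apply: ii; rewrite ijE vE DVK.
  have /continuous_closedP ic' := ic; have /continuous_closedP cD'' := cD'.
  by apply: ic'; apply: cD''; exact: icl.
have [K cK K0] := manifold_compact_chart mH cH c'X c'1.
have jonto := locally_compact_embedding_onto je cK K0.
have Q1 : carrier Q (coset_proj L 1) by rewrite QE; exists 1.
have [q qQ q1] := manifold_cover mQ Q1; have qc := manifold_chart mQ qQ.
have [P [lP cP PD]] := tder_exists mH mQ spi c'c qc c'1 q1.
have piL h : L h -> coset_proj L h = coset_proj L 1.
  by move=> Lh; apply: (coset_projP _ _ Lg).2; rewrite mulg1; exact: LV.
have P0 h : P h = 0.
  have [u _ <-] := jonto h.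
  have qphi1 : dom q (coset_proj L (phi 1)) by rewrite phi1.
  have t1 : tder (coset_proj L \o phi) c' q 1 u (P (j u)).
    apply: (tder_comp mH mQ sphi spi c'c c'c qc c'1 c'phi1 qphi1 (jD u)).
    by rewrite phi1.
  have t0 : tder (coset_proj L \o phi) c' q 1 u 0.
    apply: (@tder_cst _ _ _ XH _ c' q 1 u c'c c'1) => y Hy /=.
    by rewrite !piL //; exact: aHL.
  exact: (tder_unique qc.1 t1 t0).
pose l := chi (coset_proj L 1).
have Ll : L l.
  by have := (coset_projP l 1 Lg).1 (chiK _ U1); rewrite mulg1 => /LV; rewrite invgK.
(* [chi] may hit [L] away from the identity, where [c'] is centred: correct by
   a right translation, which does not change the cosets *)
pose sigma u := chi u * l^-1.
have sU := open_submanifold mQ oU; have mU := sub_space_manifold mQ sU.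
have sR : smooth_map XH XH (fun g => g * l^-1).
  apply: (smooth_map_into mH mG Hs); first by move=> h Hh; apply: HM => //; exact/HV/LH.
  exact: smooth_map_restrict (smooth_mulr _).
have ssig : smooth_map (sub_space Q U) XH sigma by exact: smooth_map_comp schi sR.
have sigK u : U u -> coset_proj L (sigma u) = u.
  move=> Uu; rewrite -[RHS](chiK u Uu); apply: (coset_projP _ _ Lg).2.
  by rewrite /sigma invgM invgK mulgVK.
pose qU := restrict_chart q U.
have qUc : compatible_chart (sub_space Q U) qU.
  by apply: (manifold_chart mU); exact: restrict_sub_chart.
have qU1 : dom qU (coset_proj L 1) by split.
have sig1 : sigma (coset_proj L 1) = 1 by rewrite /sigma mulgV.
have c'sig1 : dom c' (sigma (coset_proj L 1)) by rewrite sig1.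
have [B [_ _ BD]] := tder_exists mU mH ssig qUc c'c qU1 c'sig1.
(* the differential of the identity [coset_proj L \o sigma] factors through [P] *)
have model0 (h : model q) : h = 0.
  have qsig1 : dom q (coset_proj L (sigma (coset_proj L 1))) by rewrite sig1.
  have t1 : tder (coset_proj L \o sigma) qU q (coset_proj L 1) h (P (B h)).
    apply: (tder_comp mH mQ ssig spi qUc c'c qc qU1 c'sig1 qsig1 (BD h)).
    by rewrite sig1.
  rewrite P0 in t1; apply: (dirderiv_unique (chart_hausdorff qc.1) _ t1).
  apply: (@dirderiv_eqon _ _ _ (cod qU) (fun y : model q => y)).
  - exact: chart_open qUc.1.
  - move=> y [cy Uy]; rewrite /rep /=.
    by rewrite sigK // (paramK qc.1).
  - exact: (chart_coord qUc.1).
  exact: dirderiv_id.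
have [W oW WE] := chart_rel_open qc.1.
exists (coset_proj L @^-1` W).
  by move: W oW {WE}; apply/continuousP; exact: coset_proj_continuous.
apply/seteqP; split => [h Lh|h [Hh Wh]].
  split; first exact: LH.
  have : dom q (coset_proj L h) by rewrite piL.
  by rewrite WE => -[].
have dh : dom q (coset_proj L h) by rewrite WE; split => //; rewrite QE; exists h.
have : coset_proj L 1 = coset_proj L h.
  rewrite -(coordK qc.1 q1) -(coordK qc.1 dh).
  by rewrite [coord q _]model0 [coord q (coset_proj L h)]model0.
by move=> /(coset_projP _ _ Lg).1; rewrite invg1 mul1g.
Qed.

(** Iterating the conjugation yields a decreasing sequence of clopen subgroups of
    the compact and locally connected group [H]. It becomes stationary, and then
    injectivity carries the equality back to the first step. *)
Lemma conjugate_subgroup_eq H a :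
  lie_subgroup G H -> compact H -> hausdorff_space Gt -> conjL a @` H `<=` H ->
  rel_open H (conjL a @` H) -> conjL a @` H = H.
Proof.
move=> [Hg Hs] cH hG aH oL.
have mH := sub_space_manifold mG Hs.
pose f := conjL a; pose L n := iter n f @` H.
have fK : cancel f (conjL a^-1) := conjLK a.
have finj : injective f := can_inj fK.
have LS n : L n.+1 = f @` L n.
  apply/seteqP; split => [_ [h Hh <-]|_ [_ [h Hh <-] <-]]; last by exists h.
  by exists (iter n f h) => //; exists h.
have Ldec n : L n.+1 `<=` L n.
  by move=> _ [h Hh <-]; exists (f h); [apply: aH; exists h|rewrite -iterSr].
have LH n : L n `<=` H.
  by elim: n => [|n IH]; [rewrite /L image_id|move=> h /Ldec/IH].
have cL n : compact (L n).
  elim: n => [|n IH]; first by rewrite /L image_id.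
  rewrite LS; apply: continuous_compact => //; apply: continuous_subspaceT.
  exact: conj_continuous.
have oLS n : rel_open (L n) (L n.+1).
  elim: n => [|n [V oV VE]]; first by rewrite LS /L image_id.
  exists (conjL a^-1 @^-1` V).
    by move: V oV {VE}; apply/continuousP; exact: conj_continuous.
  have -> : L n.+2 = f @` (L n `&` V) by rewrite LS VE.
  rewrite LS; apply/seteqP; split => [_ [h [Lh Vh] <-]|_ [[h Lh <-] Vh]].
    by split; [exists h|rewrite /preimage /= fK].
  by exists h => //; split => //; move: Vh; rewrite /preimage /= fK.
have [|||n Ln] := @clopen_chain_stops Gt H L cH _ LH Ldec.
- by move=> p Hp; exact: (manifold_locally_connected mH).
- elim=> [|n IH]; first by exists setT; [exact: openT|rewrite /L image_id setIT].
  exact: rel_open_trans IH (oLS n).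
- move=> n; exists (L n); first exact: compact_closed.
  by rewrite setIC (setIidl (LH n)).
suff : L 1%N = L 0%N by rewrite LS /L image_id.
elim: n Ln => [//|n IH] Ln; apply: IH; move: Ln; rewrite [in LHS]LS [in RHS]LS.
by move=> Ln; apply: (image_injective finj) Ln.
Qed.

End WholeGroup.

End LieSubgroups.

(** * Submanifold charts from embeddings *)

Section EmbeddedCharts.
Context {R : realType}.

Lemma embedding_prodr (E F F' : tvsType R) (i : F -> F') :
  closed_linear_embedding i ->
  closed_linear_embedding (fun p : E * F => (p.1, i p.2)).
Proof.
move=> ie; have [il ii ic icl] := ie; split.
- by move=> a [u v] [u' v']; congr pair => /=; rewrite il.
- by move=> [u v] [u' v'] [-> /ii ->].
- move=> [u v]; apply: (@cvg_pair _ _ _ _ (nbhs u) (nbhs (i v))).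
    exact: cvg_fst.
  apply: (@cvg_comp _ _ _ _ i _ (nbhs v)); [exact: cvg_snd|exact: ic].
move=> C cC [y v'] cl.
have [v _ vE] : range i v'.
  apply: embedding_range_closed ie _ _ => B Bv'.
  have [|[z z'] [[[u w] Cuw [_ wz]] [/= _ Bz]]] := cl (setT `*` B).
    by exists (setT, B) => //; split => //=; exact: filterT.
  by exists z'; split => //; exists w.
rewrite -vE in cl *; exists (y, v) => //; apply: cC => N [[A B] /= [Ay Bv] ABN].
move: Bv; rewrite nbhsE => -[B' [oB' B'v] BB].
have cB : closed (i @` (~` B')) by apply: icl; exact: open_closedC.
have nB : nbhs (i v) (~` (i @` (~` B'))).
  apply: open_nbhs_nbhs; split; first exact: closed_openC.
  by move=> [u Bu /ii uv]; apply: Bu; rewrite uv.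
have [|[z z'] [[[u w] Cuw [uz wz]] [/= Az Bz]]] := cl (A `*` (~` (i @` (~` B')))).
  by exists (A, ~` (i @` (~` B'))).
exists (u, w); split => //; apply: ABN; split => /=; first by rewrite uz.
apply: BB; apply: contrapT => nw; apply: Bz; exists w => //.
Qed.

(** The coordinates of a point of [A] are the preimage under [i] of its
    coordinates in [P]. *)
Lemma sub_chart_exists (T : topologicalType) (X : smooth_space R T) (A : set T)
    (P : chart R T) (F : tvsType R) (i : F -> model P) :
  compatible_chart X P -> closed_linear_embedding i ->
  coord P @` (dom P `&` A) = cod P `&` range i ->
  exists2 c, sub_chart X A c & dom c = dom P `&` A.
Proof.
move=> PX ie PA; have [il ii ic icl] := ie.
exists (Chart F (dom P `&` A) (i @^-1` cod P)
  (fun x => xget 0 [set y | i y = coord P x]) (param P \o i)) => //.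
exists P, i; split; split => // x /set_mem xA /=.
have [_ [y _ yE]] : (cod P `&` range i) (coord P x) by rewrite -PA; exists x.
by case: xgetP => [z -> //|/(_ y)/(_ yE)].
Qed.

Lemma lcs_manifold (E : tvsType R) : hausdorff_space E -> manifold (lcs_space E).
Proof.
move=> hE; split.
- by apply/hausdorff_onP; apply/hausdorff_onT.
- by move=> x _; exists (Chart E setT setT id id).
- move=> _ ->; split.
    split; [split|split; [split|split]] => //=.
    + by exists setT; [exact: openT|rewrite setTI].
    + exact: openT.
    + exact: within_id.
    + exact: within_id.
  by move=> _ ->; split => k; exact: Ck_id.
Qed.

End EmbeddedCharts.

(** * Stabilizers and orbit types *)

Section Actions.
Context {R : realType} {Gt : preTopologicalGroupType} {T : topologicalType}.
Context (G : smooth_space R Gt) (M : smooth_space R T) (act : Gt -> T -> T).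
Hypotheses (GT : carrier G = setT) (Glie : lie_group G).
Hypotheses (MT : carrier M = setT) (MG : G_manifold G M act).
Hypothesis act_proper : proper_action G M act.

Let mG : manifold G. Proof. by case: Glie. Qed.
Let mM : manifold M. Proof. by case: MG. Qed.

Let act1 x : act 1%g x = x.
Proof. by case: MG => _ + _ _; apply; rewrite MT. Qed.

Let actM g h x : act (g * h)%g x = act g (act h x).
Proof. by case: MG => _ _ + _; apply; rewrite ?MT ?GT. Qed.

Let actK g x : act g^-1%g (act g x) = x.
Proof. by rewrite -actM mulVg act1. Qed.

Let stabE x g : stab G act x g <-> act g x = x.
Proof. by rewrite /stab /= GT; split => [[]|]. Qed.

Lemma space_hausdorff : hausdorff_space T.
Proof. by apply/hausdorff_onT; rewrite -MT; apply/hausdorff_onP; case: mM. Qed.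

Lemma group_hausdorff : hausdorff_space Gt.
Proof. by apply/hausdorff_onT; rewrite -GT; apply/hausdorff_onP; case: mG. Qed.

Lemma conj_eqP H K : conj_eq G H K <-> exists a, conjL a @` H = K.
Proof. by split=> [[a _ aH]|[a aH]]; exists a => //; rewrite GT. Qed.

Lemma conj_leP H K : conj_le G H K <-> exists a, conjL a @` H `<=` K.
Proof. by split=> [[a _ aH]|[a aH]]; exists a => //; rewrite GT. Qed.

Lemma conj_image (a b : Gt) (H : set Gt) : conjL a @` (conjL b @` H) = conjL (a * b)%g @` H.
Proof.
by rewrite image_comp; congr image; apply/funext => h /=; exact: conjLM.
Qed.

Lemma conj_image1 (H : set Gt) : conjL 1%g @` H = H.
Proof.
by apply/seteqP; split => [_ [h Hh <-]|h Hh]; [rewrite conjL1|exists h; rewrite ?conjL1].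
Qed.

Lemma conj_eq_refl H : conj_eq G H H.
Proof. by apply/conj_eqP; exists 1%g; exact: conj_image1. Qed.

Lemma conj_eq_sym H K : conj_eq G H K -> conj_eq G K H.
Proof.
move=> /conj_eqP[a <-]; apply/conj_eqP; exists a^-1%g.
by rewrite conj_image mulVg conj_image1.
Qed.

Lemma conj_eq_trans H K L : conj_eq G H K -> conj_eq G K L -> conj_eq G H L.
Proof.
move=> /conj_eqP[a <-] /conj_eqP[b <-]; apply/conj_eqP; exists (b * a)%g.
by rewrite conj_image.
Qed.

Lemma stab_act g x : stab G act (act g x) = conjL g @` stab G act x.
Proof.
apply/seteqP; split => [h /stabE hx|_ [h /stabE hx <-]].
  exists (conjL g^-1%g h); last exact: conjLVK.
  by apply/stabE; rewrite /conjL invgK !actM hx actK.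
by apply/stabE; rewrite /conjL !actM actK hx.
Qed.

Lemma conj_eq_act g x H : conj_eq G (stab G act (act g x)) H <-> conj_eq G (stab G act x) H.
Proof.
have gx : conj_eq G (stab G act x) (stab G act (act g x)).
  by apply/conj_eqP; exists g; rewrite stab_act.
by split; [exact: conj_eq_trans|apply: conj_eq_trans; exact: conj_eq_sym].
Qed.

Lemma type_eqE H x : type_eq G M act H x <-> conj_eq G (stab G act x) H.
Proof. by rewrite /type_eq /= MT; split => [[]|]. Qed.

Lemma type_eq_act g x H : type_eq G M act H (act g x) <-> type_eq G M act H x.
Proof. by rewrite !type_eqE conj_eq_act. Qed.

Lemma type_eq_stab x y H : stab G act x = stab G act y ->
  type_eq G M act H x -> type_eq G M act H y.
Proof. by rewrite !type_eqE => ->. Qed.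

Lemma type_eq_conj H K : conj_eq G H K -> type_eq G M act H = type_eq G M act K.
Proof.
move=> HK; apply/seteqP; split => x /type_eqE xH; apply/type_eqE.
  exact: conj_eq_trans HK.
by apply: conj_eq_trans xH _; exact: conj_eq_sym.
Qed.

Lemma stab_subgroup x : is_subgroup (stab G act x).
Proof.
split; first by apply/stabE; rewrite act1.
  by move=> g h /stabE gx /stabE hx; apply/stabE; rewrite actM hx gx.
by move=> g /stabE gx; apply/stabE; rewrite -{1}gx actK.
Qed.

(** It is the projection of the preimage of the point [(x, x)] under the proper
    map of the action. *)
Lemma stab_compact x : compact (stab G act x).
Proof.
have cC : compact [set (x, x)] by exact: compact_set1.
have := act_proper _ cC; rewrite MT GT => /(_ _) cP.
have -> : stab G act x = fst @` ((setT `*` setT) `&`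
    (fun p : Gt * T => (act p.1 p.2, p.2)) @^-1` [set (x, x)]).
  apply/seteqP; split => [g /stabE gx|_ [[g y] [_ [/= gy yx]] <-]].
    by exists (g, x) => //; split => //=; rewrite gx.
  by apply/stabE => /=; rewrite -{1}yx.
apply: continuous_compact; last exact: cP.
by apply: continuous_subspaceT => p; exact: cvg_fst.
Qed.

(** * Slices *)

Section Slice.
Context (m : T) (S : set T).
Hypothesis slS : slice G M act m S.

Let sS : submanifold M S. Proof. by case: slS. Qed.
Let mS : manifold (sub_space M S). Proof. exact: sub_space_manifold. Qed.

Lemma slice_stab_sub s : S s -> stab G act s `<=` stab G act m.
Proof.
move=> Ss g /stabE gs; case: slS => _ _ [_ SL2 _ _].
by apply: SL2; rewrite ?GT //; exists s; split => //; exists s.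
Qed.

(** The second component of the inverse of the tube diffeomorphism. *)
Lemma slice_retraction : exists (V : set T) (r : T -> T),
  [/\ open V, V m, {within V, continuous r}
    & forall a, V a -> S (r a) /\ exists g, a = act g (r a)].
Proof.
have [_ Sm [_ _ [_ [Q [mQ _ _ _] [U [chi [V [[oU U1 schi chiK]
  [oV Vm [sF [g [sg Fg gF]]]]]]]]]] _]] := slS.
exists V, (snd \o g); split => //.
- by have [W oW ->] := oV; rewrite MT setTI.
- have [gV cg _] := sg.
  apply: (@within_comp _ _ _ _ setT g snd) => //.
  by apply: continuous_subspaceT => p; exact: cvg_snd.
move=> a Va; have [gV _ _] := sg; have [_ Sga] := gV _ Va; split => //.
by exists (chi (g a).1); rewrite -[LHS](gF a) // inE.
Qed.

(** The tube is a product of [G / G_m] and the slice. Its charts express the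
    action by local sections [sigma] of [G -> G / G_m], so that a [G]-invariant
    set is, in such a chart, a product with its trace on the slice. *)
Lemma slice_chart (w : chart R T) : compatible_chart (sub_space M S) w ->
  exists (E : tvsType R) (N : set E) (sigma : E -> Gt)
    (k : T -> E * model w) (D : set T),
    compatible_chart M (Chart (E * model w)%type D (N `*` cod w) k
      (fun p => act (sigma p.1) (param w p.2))) /\ (dom w m -> D m).
Proof.
move=> wS; have [_ Sm [_ _ [_ [Q [mQ _ _ _] [U [chi [V [[oU U1 schi chiK]
  [oV Vm [sF [g [sg Fg gF]]]]]]]]]] _]] := slS.
have sU := open_submanifold mQ oU; have mU := sub_space_manifold mQ sU.
have sV := open_submanifold mM oV; have mV := sub_space_manifold mM sV.
have [q qQ q1] := manifold_cover mQ (rel_open_sub oU U1).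
have qc := manifold_chart mQ qQ; pose qU := restrict_chart q U.
have qUc : compatible_chart (sub_space Q U) qU.
  by apply: (manifold_chart mU); exact: restrict_sub_chart.
have pc := prod_compatible mU mS qUc wS.
have mUS := prod_manifold mU mS.
have tc := transport_compatible mUS mV sF sg Fg gF pc.
exists (model q), (cod qU), (fun y => chi (param qU y)), (coord (prod_chart qU w) \o g),
  (V `&` g @^-1` dom (prod_chart qU w)); split.
  exact: open_sub_space_compatible oV tc.
move=> wm; split => //.
have chi1 : act (chi (coset_proj (stab G act m) 1%g)) m = m.
  apply/stabE; have Lg := stab_subgroup m.
  have := (coset_projP _ _ Lg).1 (chiK _ U1); rewrite mulg1.
  by case: Lg => _ _ LV /LV; rewrite invgK.
have gm : g m = (coset_proj (stab G act m) 1%g, m).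
  rewrite -[in LHS]chi1; apply: (Fg (coset_proj (stab G act m) 1%g, m)).
  by rewrite inE; split.
by rewrite /preimage /= gm; split.
Qed.

(** By (SL4) the trace of [M_(H)] on the slice is a submanifold, and in the tube
    [M_(H)] is the product with this trace. *)
Lemma type_eq_sub_chart H : type_eq G M act H m ->
  exists2 c, sub_chart M (type_eq G M act H) c & dom c m.
Proof.
move=> mH; have [_ Sm [_ _ _ [[_ sA] _]]] := slS.
have HE : type_eq G M act (stab G act m) = type_eq G M act H.
  by apply: type_eq_conj; apply/type_eqE.
rewrite HE in sA.
have [c'' [c [i [[cS ie cA] [dE oE iE pE]]]] c''m] := sA m (conj Sm mH).
have [E [N [sigma [k [D [PM PD]]]]]] := slice_chart cS.
have cm : dom c m by move: c''m; rewrite dE => -[].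
set P := Chart _ _ _ _ _ in PM.
have [|c0 c0A c0E] := @sub_chart_exists R T M (type_eq G M act H) P (E * model c'')%type
  (fun p => (p.1, i p.2)) PM (@embedding_prodr R E (model c'') (model c) i ie).
  apply/seteqP; split => [_ [a [aD aH] <-]|[y z] [Pyz [[y' u] _ [yE uE]]]].
    split; first exact: (chart_coord PM.1).
    have := coordK PM.1 aD; have := chart_coord PM.1 aD.
    case: (coord P a) => y z [/= Ny cz] aE.
    have : (cod c `&` range i) z.
      rewrite -cA; exists (param c z); last exact: (paramK cS.1).
      split; first exact: (chart_param cS.1).
      split; first exact: (chart_sub cS.1 (chart_param cS.1 cz)).
      by rewrite -(type_eq_act (sigma y)) aE.
    by move=> [_ [u _ <-]]; exists (y, u).
  exists (param P (y, z)); last exact: (paramK PM.1).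
  split; first exact: (chart_param PM.1).
  apply/type_eq_act => /=; case: Pyz => /= Ny cz.
  have : (cod c `&` range i) z by split => //; exists u.
  by rewrite -cA => -[x [dx [_ xH]] <-]; rewrite (coordK cS.1).
by exists c0 => //; rewrite c0E; split => //; exact: PD.
Qed.

(** The stabilizer of [s] is contained in [G_m] by (SL2) and conjugate to it. The
    slice at [s] for the action of [G_m] on [S] provides the quotient
    [G_m / G_s] with its section. *)
Lemma slice_stab_eq s (S' : set T) : S s ->
  slice (sub_space G (stab G act m)) (sub_space M S) act s S' ->
  type_eq G M act (stab G act m) s -> stab G act s = stab G act m.
Proof.
move=> Ss [_ _ [_ _ SL3' _]] /type_eqE/conj_eq_sym/conj_eqP[a aL].
have [_ _ [_ _ [lH _] _]] := slS.
have LE : stab (sub_space G (stab G act m)) act s = stab G act s.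
  apply/seteqP; split => g; first by move=> [_ gs]; apply/stabE.
  by move=> gs; split; [exact: slice_stab_sub gs|apply/stabE].
move: SL3'; rewrite /SL3 LE.
move=> [_ [Q [mQ QE spi _] [U [chi [V [[oU U1 schi chiK] _]]]]]].
have LH : conjL a @` stab G act m `<=` stab G act m.
  by rewrite aL; exact: slice_stab_sub.
have oL : rel_open (stab G act m) (stab G act s).
  have aHL h : stab G act m h -> stab G act s (conjL a h).
    by move=> Hh; rewrite -aL; exists h.
  exact: (conjugate_subgroup_open GT Glie lH (@stab_compact m) (stab_subgroup s)
    (slice_stab_sub Ss) aHL mQ QE spi oU U1 schi chiK).
rewrite -aL; apply: (conjugate_subgroup_eq GT Glie lH (@stab_compact m) group_hausdorff LH).
by rewrite aL.
Qed.

End Slice.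

(** * Linear slices *)

Section LinearSlice.
Context (m : T) (S : set T).
Hypothesis slS : slice G M act m S.
Hypothesis nested : forall s, S s -> exists S' : set T,
  slice (sub_space G (stab G act m)) (sub_space M S) act s S'.
Context (E : tvsType R) (rho : Gt -> E -> E) (W : set E) (f : E -> T).
Hypotheses (hE : hausdorff_space E)
  (rhoP : continuous_representation (stab G act m) rho) (oW : open W) (W0 : W 0)
  (Wrho : forall g x, stab G act m g -> W x -> W (rho g x))
  (sf : diffeo (sub_space (lcs_space E) W) (sub_space M S) f) (f0 : f 0 = m)
  (frho : forall g x, stab G act m g -> W x -> f (rho g x) = act g (f x)).

Let oWr : rel_open (carrier (lcs_space E)) W.
Proof. by exists W => //; rewrite setTI. Qed.

Lemma linear_slice_in x : W x -> S (f x).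
Proof. by case: sf => -[+ _ _] _; exact. Qed.

Lemma linear_slice_inj x y : W x -> W y -> f x = f y -> x = y.
Proof.
case: sf => _ [g [_ fK _]] Wx Wy fxy.
by rewrite -(fK x (mem_set Wx)) -(fK y (mem_set Wy)) fxy.
Qed.

Lemma linear_slice_stab x : W x ->
  stab G act (f x) = [set g | stab G act m g /\ rho g x = x].
Proof.
move=> Wx; apply/seteqP; split => g.
  move=> gx; have mg := slice_stab_sub slS (linear_slice_in Wx) gx; split => //.
  by apply: linear_slice_inj => //; [exact: Wrho|rewrite frho //; apply/stabE].
by move=> [mg gx]; apply/stabE; rewrite -frho // gx.
Qed.

Definition fixed_vectors : set E := [set x | forall g, stab G act m g -> rho g x = x].

Lemma fixed_vectors_closed : closed fixed_vectors.
Proof.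
have [rl _ _ rc] := rhoP.
have -> : fixed_vectors = \bigcap_(g in stab G act m) [set x | rho g x - x = 0].
  apply/seteqP; split => x fx g mg; first by rewrite /= fx // subrr.
  by apply/subr0_eq; exact: fx.
apply: closed_bigI => g mg.
have cg : continuous (rho g).
  move=> x; have /subspace_continuousP/(_ (g, x) (conj mg I)) := rc => cgx.
  move=> N /cgx; rewrite /within /= => -[[A B] /= [Ag Bx] ABN].
  apply: filterS Bx => y By; apply: (ABN (g, y)) => //; split => //=.
  exact: nbhs_singleton.
have c0 : closed [set (0 : E)].
  by apply: compact_closed => //; exact: compact_set1.
have cB : continuous (fun x => rho g x - x).
  by move=> x; apply: tvs_cvgB; [exact: cg|exact: cvg_id].
exact: ((continuous_closedP _).1 cB _ c0).
Qed.

Lemma fixed_vectors0 : fixed_vectors 0.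
Proof. by move=> g mg; case: rhoP => rl _ _ _; exact: (linear_fun0 (rl g mg)). Qed.

Lemma fixed_vectors_linear a u v :
  fixed_vectors u -> fixed_vectors v -> fixed_vectors (a *: u + v).
Proof. by case: rhoP => rl _ _ _ fu fv g mg; rewrite rl // fu // fv. Qed.

Lemma linear_slice_stabD x z : fixed_vectors z -> W x -> W (x + z) ->
  stab G act (f (x + z)) = stab G act (f x).
Proof.
case: rhoP => rl _ _ _ fz Wx Wxz; rewrite !linear_slice_stab //.
apply/seteqP; split => g [mg gx]; split => //.
  apply: (@addIr _ z); rewrite -[in RHS]gx -[in LHS](fz g mg).
  by rewrite (linear_funD (rl g mg)).
by rewrite (linear_funD (rl g mg)) gx fz.
Qed.

Lemma fixed_vectors_type x : W x -> type_eq G M act (stab G act m) (f x) ->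
  fixed_vectors x.
Proof.
move=> Wx fxm; have [S' slS'] := nested (linear_slice_in Wx).
have := slice_stab_eq slS (linear_slice_in Wx) slS' fxm.
rewrite linear_slice_stab // => fE g mg.
by have [] : [set g | stab G act m g /\ rho g x = x] g by rewrite fE.
Qed.

(** Let [E^H] be the space of vectors fixed by the stabilizer of [m], and [Q] the
    model space of [G / G_m]. In the tube chart [P], with model space [Q * E], the
    tangent space of [M_(H)] at [m] lies in [Q * E^H] by [fixed_vectors_type],
    while that of [M_(K)] at [v] contains [Q * E^H] by [linear_slice_stabD]. The
    inclusion is the desired injection; [e] being a closed embedding, it is
    continuous as a map into the tangent space at [v]. *)
Lemma orbit_type_tangent_maps H : type_eq G M act H m ->
  submanifold M (type_eq G M act H) -> exists V, [/\ open V, V m &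
    forall K v, submanifold M (type_eq G M act K) -> V v -> type_eq G M act K v ->
    exists A, injective_continuous_linear
         (sub_space M (type_eq G M act H)) m
         (sub_space M (type_eq G M act K)) v A].
Proof.
move=> mH sH; have [_ Sm _] := slS; have sS : submanifold M S by case: slS.
have mS := sub_space_manifold mM sS.
have HE : type_eq G M act (stab G act m) = type_eq G M act H.
  by apply: type_eq_conj; apply/type_eqE.
have mlE := lcs_manifold hE; have sW := open_submanifold mlE oWr.
have mW := sub_space_manifold mlE sW.
have [sff [g [sg fK gK]]] := sf.
pose c1 := Chart E setT setT id id : chart R E.
have c1E : compatible_chart (lcs_space E) c1 by apply: (manifold_chart mlE).
have c2W : compatible_chart (sub_space (lcs_space E) W) (restrict_chart c1 W).
  by apply: (manifold_chart mW); exact: restrict_sub_chart.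
have wS := transport_compatible mW mS sff sg fK gK c2W.
have [Q [N [sigma [k [D [PM PD]]]]]] := slice_chart slS wS.
set P := Chart _ _ _ _ _ in PM.
have Dm : D m.
  apply: PD; split => //; split => //.
  by rewrite -f0 fK // inE.
have PmD : dom P m := Dm.
have [V oV VE] := chart_rel_open PM.1; rewrite MT setTI in VE.
exists V; split => //; first by rewrite -VE.
move=> K v sK; rewrite -VE => vD vK.
have sid := smooth_map_id mM.
have [c' c'A c'm] := sH.2 m mH; have [d' d'B d'v] := sK.2 v vK.
have mXH := sub_space_manifold mM sH; have mXK := sub_space_manifold mM sK.
have [c [i [[cM ie cA] [dE oE iE pE]]]] := c'A.
have [d [e [[dM ee dA] [dE' oE' eE pE']]]] := d'B.
have [il ii ic _] := ie; have [el ei ec _] := ee.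
have cm : dom c m by move: c'm; rewrite dE => -[].
have dv : dom d v by move: d'v; rewrite dE' => -[].
have [D1 [lD1 cD1 D1D]] := tder_exists mM mM sid cM PM cm PmD.
have [D1' [_ _ D1D']] := tder_exists mM mM sid PM cM PmD cm.
have [D2 [lD2 cD2 D2D]] := tder_exists mM mM sid PM dM vD dv.
have [D2' [_ _ D2D']] := tder_exists mM mM sid dM PM dv vD.
have D1K := tder_transition_cancel mM cM PM cm PmD D1D D1D'.
have D2K := tder_transition_cancel mM PM dM vD dv D2D D2D'.
have Nsplit a : dom P a -> exists y x, [/\ coord P a = (y, x), N y, W x
    & a = act (sigma y) (f x)].
  move=> aD; have := coordK PM.1 aD; have := chart_coord PM.1 aD.
  by case: (coord P a) => y x [/= Ny [_ Wx]] aE; exists y, x.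
pose Z : set (Q * E) := [set p | fixed_vectors p.2].
have Zcl : closed Z.
  have cs : continuous (@snd Q E) by move=> p; exact: cvg_snd.
  exact: ((continuous_closedP _).1 cs _ fixed_vectors_closed).
have ZL a (p q : Q * E) : Z p -> Z q -> Z (a *: (p - q)).
  move=> Zp Zq; rewrite /Z /=.
  have -> : a *: (p.2 - q.2) = a *: p.2 + ((- a) *: q.2 + 0).
    by rewrite addr0 scalerBr scaleNr.
  apply: fixed_vectors_linear => //; apply: fixed_vectors_linear => //.
  exact: fixed_vectors0.
have AZ a : type_eq G M act H a -> dom P a -> Z (coord P a).
  move=> aH aD; have [y [x [-> Ny Wx aE]]] := Nsplit a aD.
  apply: fixed_vectors_type => //; rewrite HE.
  by rewrite -(type_eq_act (sigma y)) -aE.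
(* the tangent space of [M_(H)] at [m] lies in [Z] *)
have D1Z u : Z (D1 (i u)).
  apply: (sub_tangent_in mM cM PM cA il _ cm PmD D1D Zcl ZL (AZ m mH PmD) AZ).
  exact: esym (iE m (mem_set c'm)).
(* [Z] lies in the tangent space of [M_(K)] at [v] *)
have D2r z : Z z -> range e (D2 z).
  move=> Zz; apply: (sub_tangent_contains mM dM PM dA ee vK dv vD D2D).
  have := near_ray z (chart_open PM.1) (chart_coord PM.1 vD).
  apply: filterS => t; have [y [x [vE Ny Wx vE']]] := Nsplit v vD.
  rewrite vE => -[/= Nyt [_ Wxt]]; apply/type_eq_act.
  have tz : fixed_vectors (t *: z.2).
    rewrite -[_ *: _]addr0; apply: fixed_vectors_linear => //.
    exact: fixed_vectors0.
  apply: (@type_eq_stab (f x)); first by apply: esym; exact: linear_slice_stabD.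
  by rewrite -(type_eq_act (sigma y)) -vE'.
have [L LE] : {L : model c' -> model d' & forall u, e (L u) = D2 (D1 (i u))}.
  apply: (@choice _ _ (fun u l => e l = D2 (D1 (i u)))) => u.
  by have [l _ lE] := D2r _ (D1Z u); exists l.
apply: (tangent_map_exists mXH mXK c'A c'm d'B d'v (L := L)).
- by move=> a u w; apply: ei; rewrite LE il lD1 lD2 el !LE.
- move=> u; apply: (embedding_cvg ee); rewrite LE.
  have -> : e \o L = D2 \o (D1 \o i) by apply/funext => w; exact: LE.
  apply: continuous_comp; last exact: cD2.
  by apply: continuous_comp; [exact: ic|exact: cD1].
- move=> u w uw; apply: ii; apply: (can_inj D1K); apply: (can_inj D2K).
  by rewrite -!LE uw.
Qed.

End LinearSlice.

(** * The orbit type stratification *)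

Section OrbitTypeStratification.
Hypothesis slices : forall m : T, exists2 S : set T, linear_slice G M act m S &
     forall s : T, S s -> exists S' : set T,
       linear_slice (sub_space G (stab G act m)) (sub_space M S) act s S'.
Hypothesis approx : forall H : set Gt, orbit_type G M act H ->
     type_ge G M act H `<=` closure (type_eq G M act H).

Lemma type_eq_submanifold H : submanifold M (type_eq G M act H).
Proof.
split; first by rewrite MT.
by move=> x xH; have [S [slS _] _] := slices x; exact: type_eq_sub_chart slS _ xH.
Qed.

Lemma tangent_maps_near H m : type_eq G M act H m ->
  exists V, [/\ open V, V m & forall K v, V v -> type_eq G M act K v ->
    exists A, injective_continuous_linear
         (sub_space M (type_eq G M act H)) m
         (sub_space M (type_eq G M act K)) v A].
Proof.
move=> mH; have [S [slS [E [rho [W [f [[hE rP oW W0 Wr] [sf f0 fr]]]]]]] nS] := slices m.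
have nested s : S s -> exists S' : set T,
    slice (sub_space G (stab G act m)) (sub_space M S) act s S'.
  by move=> /nS[S' [sS' _]]; exists S'.
have [V [oV Vm VA]] := orbit_type_tangent_maps slS nested hE rP oW W0 Wr sf f0 fr mH
  (type_eq_submanifold H).
by exists V; split => // K v; exact: VA (type_eq_submanifold K).
Qed.

(** A point of [M_(H)] in the tube around the orbit of [x] retracts to a point
    of the slice, whose stabilizer is contained in that of [x]. *)
Lemma closure_type_le H x : closure (type_eq G M act H) x ->
  conj_le G H (stab G act x).
Proof.
move=> clx; have [S [slS _] _] := slices x.
have [V [r [oV Vx _ rP]]] := slice_retraction slS.
have [y [/type_eqE/conj_eq_sym/conj_eqP[a aH] Vy]] := clx V (open_nbhs_nbhs (conj oV Vx)).
have [Sry [g yE]] := rP y Vy.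
apply/conj_leP; exists (g^-1 * a)%g; rewrite -conj_image aH yE stab_act conj_image mulVg.
by rewrite conj_image1; exact: slice_stab_sub slS _ Sry.
Qed.

Lemma closure_type_sub H K x : orbit_type G M act H ->
  type_eq G M act K x -> closure (type_eq G M act H) x ->
  type_eq G M act K `<=` closure (type_eq G M act H).
Proof.
move=> oH /type_eqE/conj_eqP[a aK] /closure_type_le/conj_leP[b bH] y.
move=> /type_eqE/conj_eq_sym/conj_eqP[c cK]; apply: approx => //; split; first by rewrite MT.
apply/conj_leP; exists (c * a * b)%g; rewrite -cK -aK => _ [h Hh <-].
exists (conjL a (conjL b h)); last by rewrite !conjLM.
by exists (conjL b h) => //; apply: bH; exists h.
Qed.

(** By (SL4) the trace of [M_(H)] on the slice is closed in the slice; pull this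
    back under the retraction. *)
Lemma type_eq_closed_near H x : type_eq G M act H x ->
  exists V, [/\ open V, V x & V `&` closure (type_eq G M act H) `<=` type_eq G M act H].
Proof.
move=> xH; have [S [slS _] _] := slices x.
have [_ _ [_ _ _ [_ [C cC CE]]]] := slS.
have [V [r [oV Vx cr rP]]] := slice_retraction slS.
have HE : type_eq G M act (stab G act x) = type_eq G M act H.
  by apply: type_eq_conj; apply/type_eqE.
rewrite HE in CE.
exists V; split => // y [Vy cly]; have [Sry [g ->]] := rP y Vy; apply/type_eq_act.
suff : (S `&` type_eq G M act H) (r y) by case.
rewrite CE; split => //; rewrite [C](closure_id _).1 // => N ryN.
move: cr; rewrite continuous_open_subspace // => /(_ y (mem_set Vy)) cry.
have nV : nbhs y (V `&` r @^-1` N).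
  by apply: filterI; [exact: open_nbhs_nbhs|exact: cry].
have [z [zH [Vz rzN]]] := cly _ nV; exists (r z); split => //.
have [Srz [h zE]] := rP z Vz.
suff : (S `&` C) (r z) by case.
by rewrite -CE; split => //; rewrite -(type_eq_act h) -zE.
Qed.

(** If [M_(H)] meets the closure of [M_(K)] then it is contained in it, by
    [closure_type_sub]. Were a point [y] of [M_(K)] in the closure of [M_(H)],
    then [M_(H)] would have points near [y]; they lie in the closure of
    [M_(K)], hence in [M_(K)] by [type_eq_closed_near]. *)
Lemma orbit_type_stratification : stratification (orbit_type_strata G M act).
Proof.
split.
- exact: space_hausdorff.
- split.
  + move=> x; exists (sub_space M (type_eq G M act (stab G act x))).
      by exists (stab G act x) => //; exists x; [rewrite MT|exact: conj_eq_refl].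
    by apply/type_eqE; exact: conj_eq_refl.
  + by move=> _ [H [x Mx xH] ->]; exists x.
  + move=> _ _ [H oH ->] [K oK ->] [x [/= /type_eqE xH /type_eqE xK]].
    congr sub_space; apply: type_eq_conj.
    by apply: conj_eq_trans xK; exact: conj_eq_sym.
- move=> _ [H oH ->]; split.
    by apply: sub_space_manifold => //; exact: type_eq_submanifold.
  exact: submanifold_locally_closed MT (type_eq_submanifold H).
- move=> _ _ [H oH ->] [K oK ->] [/= HK0 [x [xH xK]]].
  have HK := closure_type_sub oK xH xK; split.
    move=> y yH; split; first exact: HK.
    by move=> yK; have : (type_eq G M act H `&` type_eq G M act K) y by []; rewrite HK0.
  apply/seteqP; split => // y [yK yH].
  have [V [oV Vy VK]] := type_eq_closed_near yK.
  have [z [zH Vz]] := yH V (open_nbhs_nbhs (conj oV Vy)).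
  have zK : type_eq G M act K z by apply: VK; split => //; exact: HK.
  by have : (type_eq G M act H `&` type_eq G M act K) z by []; rewrite HK0.
Qed.

End OrbitTypeStratification.

End Actions.

Theorem proposition4p10 (R : realType)
  (Gt : preTopologicalGroupType) (G : smooth_space R Gt)
  (T : topologicalType) (M : smooth_space R T) (act : Gt -> T -> T)
  (G_whole : carrier G = setT) (G_lie : lie_group G)
  (M_whole : carrier M = setT) (M_Gmfd : G_manifold G M act)
  (act_proper : proper_action G M act)
  (slices : forall m : T, exists2 S : set T, linear_slice G M act m S &
     forall s : T, S s -> exists S' : set T,
       linear_slice (sub_space G (stab G act m)) (sub_space M S) act s S')
  (approx : forall H : set Gt, orbit_type G M act H ->
     type_ge G M act H `<=` closure (type_eq G M act H)) :
  (forall K H : set Gt, orbit_type G M act K -> orbit_type G M act H ->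
     conj_le G K H ->
     forall m : T, type_eq G M act H m ->
     exists V : set T, [/\ open V, V m &
       forall v : T, (V `&` type_eq G M act K) v ->
       exists A, injective_continuous_linear
         (sub_space M (type_eq G M act H)) m
         (sub_space M (type_eq G M act K)) v A]) /\
  smoothly_regular (orbit_type_strata G M act).
Proof.
have near H m := tangent_maps_near G_whole G_lie M_whole M_Gmfd act_proper
  slices (H := H) (m := m).
split=> [K H _ _ _ m /near[V [oV Vm VA]]|].
  by exists V; split => // v [Vv vK]; exact: VA.
split; first exact: (orbit_type_stratification G_whole M_whole M_Gmfd slices approx).
move=> _ _ [H _ ->] [K _ ->] _ x /near[V [oV Vx VA]].
by exists V; split => // y; exact: VA.
Qed.
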